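(* Let $(\Omega,\mathsf d)$ be a compact $n$-dimensional Alexandrov space with curvature bounded below by $k$ and diameter bounded above by $D$. Then there exists a constant $C=C(n,k,D)>0$ such that, for every $0<\varepsilon<1/2$, $$\log\mathcal N\bigl(\mathcal P(\Omega),W_2,\varepsilon\bigr)\le C\,\varepsilon^{-n}\log\frac{C}{\varepsilon}.$$ Consequently, for every $\eta>0$ there is a constant $C_\eta>0$ (depending on $\eta,n,k,D$) such that, for every $0<\varepsilon<1/2$, $$\log\mathcal N\bigl(\mathcal P(\Omega),W_2,\varepsilon\bigr)\le C_\eta\,\varepsilon^{-(n+\eta)}.$$
   Context: $\mathcal P(\Omega)$ is the set of Borel probability measures on $\Omega$. $W_2$ is the Wasserstein distance with cost $c(x,y)=\frac12\mathsf d^2(x,y)$, i.e. $W_2^2(\mu,\rho)$ is the minimal value of $\int\frac12\mathsf d^2\,\mathrm d\pi$ over couplings $\pi$ of $\mu$ and $\rho$ (one half of the usual squared $L^2$-Wasserstein distance). For a metric space $(Y,d_Y)$, $\mathcal N(Y,d_Y,r)$ is the minimal number of open $d_Y$-balls of radius $r$ needed to cover $Y$. *)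

(* Defs.v *)
From HB Require Import structures.
From mathcomp Require Import all_boot all_order all_algebra.
From mathcomp Require Import all_classical all_reals all_analysis.

Set Implicit Arguments.
Unset Strict Implicit.
Unset Printing Implicit Defensive.

Import Order.TTheory GRing.Theory Num.Theory.
Import numFieldNormedType.Exports.

Local Open Scope classical_set_scope.
Local Open Scope ring_scope.

(* Nonempty metric spaces. The marked point plays no role: it is there because
   a measurableType is pointed. *)
#[short(type="pmetricType")]
HB.structure Definition PointedMetric (K : numDomainType) :=
  {M of Pointed M & Metric K M}.

(* The simply connected surface of constant curvature k, in R^3:
   k > 0: the sphere of radius 1 / sqrt k;
   k = 0: the plane z = 0;
   k < 0: the upper sheet of the hyperboloid x^2 + y^2 - z^2 = 1 / k. *)
Section model_space.
Context {R : realType}.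
Implicit Types (k : R) (u v : R * R * R).

Definition arcosh (x : R) : R := ln (x + Num.sqrt (x ^+ 2 - 1)).

Definition euclidean_form u v : R :=
  u.1.1 * v.1.1 + u.1.2 * v.1.2 + u.2 * v.2.

Definition lorentz_form u v : R :=
  u.1.1 * v.1.1 + u.1.2 * v.1.2 - u.2 * v.2.

Definition model_space k : set (R * R * R) :=
  if 0 < k then [set u | euclidean_form u u = k^-1]
  else if k < 0 then [set u | lorentz_form u u = k^-1 /\ 0 < u.2]
  else [set u | u.2 = 0].

Definition model_dist k u v : R :=
  if 0 < k then acos (k * euclidean_form u v) / Num.sqrt k
  else if k < 0 then arcosh (k * lorentz_form u v) / Num.sqrt (- k)
  else Num.sqrt ((u.1.1 - v.1.1) ^+ 2 + (u.1.2 - v.1.2) ^+ 2).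

End model_space.

Section metric_notions.
Context {R : realType}.
Implicit Type M : metricType R.

(* The diameter of the empty set is 0. *)
Definition diam M (A : set M) : \bar R :=
  Order.max 0%E
    (ereal_sup [set (mdist xy.1 xy.2)%:E | xy in A `*` A]).

Definition hausdorff_content M (s delta : R) (A : set M) : \bar R :=
  ereal_inf [set (\sum_(0 <= i <oo) poweR (diam (U i)) s)%E
            | U in [set U : nat -> set M |
                     A `<=` \bigcup_i U i /\
                     forall i, (diam (U i) <= delta%:E)%E]].

Definition hausdorff_measure M (s : R) (A : set M) : \bar R :=
  ereal_sup [set hausdorff_content s delta A
            | delta in [set delta : R | 0 < delta]].

(* Leaving out the exponent s = 0 does not change the infimum. *)
Definition hausdorff_dim M (A : set M) : \bar R :=
  ereal_inf [set s%:E | s in [set s : R | 0 < s /\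
                                          hausdorff_measure s A = 0%E]].

(* Minimizing geodesics, parametrized by arc length on [0, mdist x y]. *)
Definition geodesic M (x y : M) (gamma : R -> M) : Prop :=
  [/\ gamma 0 = x, gamma (mdist x y) = y &
      forall s t, 0 <= s <= mdist x y -> 0 <= t <= mdist x y ->
        mdist (gamma s) (gamma t) = `|s - t|].

Definition geodesic_space M : Prop :=
  forall x y : M, exists gamma, geodesic x y gamma.

(* Toponogov comparison: the distance from a vertex p of a geodesic triangle
   to a point gamma t of the opposite side is at least the corresponding
   distance in a comparison triangle (p', x', y') of the model space, z' being
   the point that corresponds to gamma t. When 0 < k, only the triangles of
   perimeter less than 2 pi / sqrt k are compared. *)
Definition curvature_ge M (k : R) : Prop :=
  forall (p x y : M) (gamma : R -> M), geodesic x y gamma ->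
  (0 < k -> mdist p x + mdist x y + mdist y p < 2 * pi / Num.sqrt k) ->
  forall p' x' y' z' : R * R * R,
    model_space k p' -> model_space k x' ->
    model_space k y' -> model_space k z' ->
    model_dist k p' x' = mdist p x ->
    model_dist k x' y' = mdist x y ->
    model_dist k y' p' = mdist y p ->
  forall t : R, 0 <= t <= mdist x y ->
    model_dist k x' z' = t ->
    model_dist k z' y' = mdist x y - t ->
    model_dist k p' z' <= mdist p (gamma t).

Definition complete_space M : Prop :=
  forall F : set_system M, ProperFilter F -> cauchy F -> exists x : M, F --> x.

Definition alexandrov_space M (k : R) : Prop :=
  [/\ complete_space M, geodesic_space M & curvature_ge M k].

(* The minimal number of open balls of radius r, with centers in Y, that cover
   Y; it is +oo when no finite family of such balls covers Y. *)
Definition covering_number (Y : Type) (dY : Y -> Y -> R) (r : R) : \bar R :=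
  ereal_inf [set N%:R%:E | N in [set N : nat |
    exists c : 'I_N -> Y, forall y, exists i, dY (c i) y < r]].

End metric_notions.

Section wasserstein.
Context {R : realType} (M : pmetricType R).

Definition borel := g_sigma_algebraType (@open M).

(* The product sigma-algebra on borel * borel is the Borel sigma-algebra of the
   product when M is separable, in particular when M is compact. *)
Definition borel_probability := probability borel R.

Definition coupling (mu rho : borel_probability) :
    set (probability (borel * borel)%type R) :=
  [set gam | forall A : set borel, measurable A ->
     gam (A `*` setT) = mu A /\ gam (setT `*` A) = rho A].

Definition transport_cost (gam : probability (borel * borel)%type R) : \bar R :=
  (\int[gam]_xy (2^-1 * mdist (xy.1 : M) (xy.2 : M) ^+ 2)%:E)%E.

(* The infimum is finite when M is bounded; fine would send an infinite one
   to 0. *)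
Definition W2 (mu rho : borel_probability) : R :=
  Num.sqrt (fine (ereal_inf (transport_cost @` coupling mu rho))).

End wasserstein.

(* Main.v *)
Require Import Defs.
From HB Require Import structures.
From mathcomp Require Import all_boot all_order all_algebra.
From mathcomp Require Import all_classical all_reals all_analysis.
From mathcomp Require Import measurable_realfun ring lra.
Import Order.TTheory GRing.Theory Num.Theory.
Import numFieldNormedType.Exports.
Local Open Scope classical_set_scope.
Local Open Scope ring_scope.

(* The exponent n comes from the self-similarity of Alexandrov spaces. By the
   comparison of angles, contracting a small ball towards a point p by a factor l
   along geodesics shrinks distances by a factor at least l / 4. So if some small
   ball, of radius r, contained K points at distance at least e from each other,
   then so would, after rescaling, every smaller ball with center in it;
   iterating yields a Cantor set in which each piece has K children, scaled by a
   ratio proportional to e / r, so that its Hausdorff dimension exceeds n unless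
   K <= (32 S / e) ^ n, where S = 2 r. Chaining small balls along geodesics gives
   a net of the whole space with O(eps ^ - n) points.
   A probability measure is then moved to the N points of an (eps / 2)-net, and
   the masses are rounded down to multiples of 1 / m, the excess going to one of
   the points. This costs at most eps ^ 2 / 8 + D ^ 2 N / (2 m), and at most
   (m + 1) ^ N measures arise. *)

(** * Triangle comparison *)

Section hyperbolic.
Context {R : realType}.
Implicit Types x y s : R.

Definition cosh x : R := (expR x + expR (- x)) / 2.
Definition sinh x : R := (expR x - expR (- x)) / 2.

Lemma cosh2Bsinh2 x : cosh x ^+ 2 - sinh x ^+ 2 = 1.
Proof.
rewrite /cosh /sinh expRN; have : expR x != 0 by rewrite expR_eq0.
by move=> ?; field.
Qed.

Lemma coshB x y : cosh (x - y) = cosh x * cosh y - sinh x * sinh y.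
Proof.
rewrite /cosh /sinh opprB !expRD !expRN.
have : expR x != 0 by rewrite expR_eq0.
have : expR y != 0 by rewrite expR_eq0.
by move=> ? ?; field; apply/andP.
Qed.

Lemma cosh_half x : cosh x = 1 + 2 * sinh (x / 2) ^+ 2.
Proof.
have -> : cosh x = cosh (x / 2 - - (x / 2)) by congr cosh; field.
have := cosh2Bsinh2 (x / 2); rewrite coshB.
have -> : cosh (- (x / 2)) = cosh (x / 2) by rewrite /cosh opprK addrC.
have -> : sinh (- (x / 2)) = - sinh (x / 2) by rewrite /sinh opprK; field.
by nra.
Qed.

Lemma sinhN x : sinh (- x) = - sinh x.
Proof. by rewrite /sinh opprK; field. Qed.

Lemma sinh0 : sinh 0 = 0.
Proof. by rewrite /sinh oppr0 subrr mul0r. Qed.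

Lemma le_sinh : {homo sinh : x y / x <= y}.
Proof.
move=> x y xy; rewrite ler_pM2r ?invr_gt0//.
by apply: lerB; rewrite ler_expR ?lerN2.
Qed.

Lemma sinh_ge0 x : 0 <= x -> 0 <= sinh x.
Proof. by move=> /le_sinh; rewrite sinh0. Qed.

Lemma sinh_gt0 x : 0 < x -> 0 < sinh x.
Proof. by move=> x0; rewrite /sinh divr_gt0// subr_gt0 ltr_expR; lra. Qed.

Lemma cosh_ge1 x : 1 <= cosh x.
Proof. by rewrite cosh_half lerDl mulr_ge0// sqr_ge0. Qed.

Lemma cosh_arcosh x : 1 <= x -> cosh (arcosh x) = x.
Proof.
move=> x1; have h : 0 <= x ^+ 2 - 1 by nra.
have hs := sqr_sqrtr h; have hs0 := sqrtr_ge0 (x ^+ 2 - 1).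
rewrite /cosh expRN /arcosh lnK ?posrE; last by nra.
have ne : x + Num.sqrt (x ^+ 2 - 1) != 0 by nra.
have -> : (x + Num.sqrt (x ^+ 2 - 1))^-1 = x - Num.sqrt (x ^+ 2 - 1).
  by apply: (mulfI ne); rewrite divff//; nra.
by field.
Qed.

Lemma arcosh_cosh x : 0 <= x -> arcosh (cosh x) = x.
Proof.
move=> x0; rewrite /arcosh.
have -> : cosh x ^+ 2 - 1 = sinh x ^+ 2 by have := cosh2Bsinh2 x; lra.
rewrite sqrtr_sqr ger0_norm ?sinh_ge0//.
have -> : cosh x + sinh x = expR x by rewrite /cosh /sinh; field.
by rewrite expRK.
Qed.

Lemma arcosh_ge0 x : 1 <= x -> 0 <= arcosh x.
Proof.
move=> x1; rewrite /arcosh ln_ge0// (le_trans x1)// lerDl sqrtr_ge0 //.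
Qed.

(** Both bounds come from [1 + x <= expR x] and [1 - x <= expR (- x)]; the upper one uses
    [x <= 1/2]. The factor 2 between them is the form in which the three model spaces are treated at
    once below. *)
Lemma sinh_bounds x : 0 <= x <= 2^-1 ->
  3 / 4 * x <= sinh x <= 2 * (3 / 4 * x).
Proof.
move=> /andP[x0 x1].
have e0 := expR_gt0 x.
have h1 := expR_ge1Dx x; have h2 := expR_ge1Dx (- x).
rewrite /sinh; move: h2; rewrite expRN; set u := expR x in e0 h1 *.
move=> h2; have hu : u * u^-1 = 1 by rewrite divff// gt_eqF.
have v0 : 0 < u^-1 by rewrite invr_gt0.
set v := u^-1 in hu v0 h2 *.
by apply/andP; split; nra.
Qed.

End hyperbolic.

(** * Linear bounds for the sine *)

Section trigonometric.
Context {R : realType}.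
Implicit Types x y s : R.

Lemma cos_half x : cos x = 1 - 2 * sin (x / 2) ^+ 2.
Proof.
have -> : cos x = cos (x / 2 + x / 2) by congr cos; field.
by rewrite cosD; have := cos2Dsin2 (x / 2); nra.
Qed.

Lemma sin_mvt x : 0 <= x -> exists2 xi, 0 <= xi <= x & sin x = x * cos xi.
Proof.
rewrite le_eqVlt => /predU1P[<-|x0].
  by exists 0; rewrite ?lexx// sin0 mul0r.
have [c cx] := @MVT R sin cos 0 x x0 (fun y _ => is_derive_sin y)
  (continuous_subspaceT (@continuous_sin R)).
rewrite sin0 !subr0 => e; exists c; last by rewrite e mulrC.
by move: cx; rewrite in_itv/= => /andP[/ltW-> /ltW->].
Qed.

(** The mean value theorem gives [sin x = x * cos xi], and [cos xi = 1 - 2 * sin (xi / 2) ^+ 2] is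
    at least 1/2 by a second application at [xi / 2]. *)
Lemma sin_bounds x : 0 <= x <= 2^-1 -> 2^-1 * x <= sin x <= 2 * (2^-1 * x).
Proof.
move=> /andP[x0 x1]; have [xi /andP[xi0 xix] ->] := sin_mvt x x0.
have := cos_le1 xi; rewrite (cos_half xi).
have [y /andP[y0 yx]] := sin_mvt (xi / 2) (divr_ge0 xi0 (ler0n _ _)) => ->.
have := cos_max y; rewrite ler_norml => /andP[h1 h2] h3.
have h4 : cos y ^+ 2 <= 1 by nra.
have h5 : (xi / 2 * cos y) ^+ 2 <= 4^-1.
  rewrite exprMn; have h6 : (xi / 2) ^+ 2 <= 4^-1 by nra.
  by have := sqr_ge0 (xi / 2); have := sqr_ge0 (cos y); nra.
by apply/andP; split; nra.
Qed.

End trigonometric.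

(** * Comparison triangles in the three model spaces *)

Section hinge.
Context {R : realType}.
Implicit Types (k S m a b c t : R) (sn : R -> R).

(* With a comparison triangle (o, x, y) of sides a = ox, b = oy, c = xy and z on
   ox, [sn] is the generalized sine of the model space up to a constant factor,
   and the last equation is the law of cosines for (o, z, y), from which the
   angle at o has been eliminated by means of the law of cosines for (o, x, y). *)
Definition model_hinge k sn S := forall a b c t,
  0 < a <= S -> 0 < b <= S -> `|a - b| <= c -> c <= a + b -> c <= S ->
  0 <= t <= a ->
  exists o x y z : R * R * R,
    [/\ model_space k o, model_space k x, model_space k y & model_space k z] /\
    [/\ model_dist k y o = b, model_dist k o x = a & model_dist k x y = c] /\
    [/\ model_dist k o z = t, model_dist k z x = a - t, 0 <= model_dist k y z &
      sn (model_dist k y z / 2) ^+ 2 = sn ((t - b) / 2) ^+ 2 +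
        sn t / sn a * (sn (c / 2) ^+ 2 - sn ((a - b) / 2) ^+ 2)].

(** All points are written in geodesic polar coordinates around [o]. The direction of [x] and [z] is
    [(1, 0)] and that of [y] is [(C, E)], the cosine and sine of the angle at [o] dictated by the
    law of cosines; the triangle inequalities amount to [-1 <= C <= 1]. *)
Lemma hyperbolic_hinge k : k < 0 ->
  model_hinge k (fun s => sinh (Num.sqrt (- k) * s)) (2^-1 / Num.sqrt (- k)).
Proof.
move=> k0 a b c t /andP[a0 aS] /andP[b0 bS] abc cab cS /andP[t0 ta].
set w := Num.sqrt (- k).
have w0 : 0 < w by rewrite sqrtr_gt0; lra.
have kw : k = - w ^+ 2 by rewrite sqr_sqrtr; lra.
have c0 : 0 <= c by rewrite (le_trans _ abc).
have ha := cosh2Bsinh2 (w * a); have hb := cosh2Bsinh2 (w * b).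
have hc := cosh2Bsinh2 (w * t).
have sa : 0 < sinh (w * a) by rewrite sinh_gt0 ?mulr_gt0.
have sb : 0 < sinh (w * b) by rewrite sinh_gt0 ?mulr_gt0.
set C := (cosh (w * a) * cosh (w * b) - cosh (w * c)) /
  (sinh (w * a) * sinh (w * b)).
have eC : C * (sinh (w * a) * sinh (w * b)) =
    cosh (w * a) * cosh (w * b) - cosh (w * c).
  by rewrite divfK// mulf_neq0// gt_eqF.
have cosh_mono x y : `|x| <= y -> cosh (w * x) <= cosh (w * y).
  move=> xy; rewrite !cosh_half lerD2l ler_pM2l//.
  wlog x0 : x xy / 0 <= x.
    case: (leP 0 x) => [x0|x0]; first exact.
    move=> /(_ (- x)); rewrite normrN oppr_ge0 (ltW x0) => /(_ xy isT).
    by rewrite mulrN mulNr sinhN sqrrN.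
  rewrite ger0_norm// in xy.
  by rewrite lerXn2r ?nnegrE ?le_sinh ?sinh_ge0 ?divr_ge0 ?mulr_ge0
    ?ler_pM2r ?ler_pM2l// ?(ltW w0)//; lra.
have C1 : C <= 1.
  rewrite -(ler_pM2r (mulr_gt0 sa sb)) eC mul1r.
  by have := cosh_mono _ _ abc; rewrite mulrBr coshB; lra.
have CN1 : -1 <= C.
  rewrite -(ler_pM2r (mulr_gt0 sa sb)) eC mulN1r.
  have := cosh_mono c (a - - b); rewrite opprK ger0_norm// => /(_ cab).
  have -> : w * (a + b) = w * a - w * - b by rewrite mulrN; ring.
  rewrite coshB mulrN sinhN.
  have -> : cosh (- (w * b)) = cosh (w * b) by rewrite /cosh opprK addrC.
  lra.
have Cq : 0 <= 1 - C ^+ 2 by nra.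
set E := Num.sqrt (1 - C ^+ 2).
have eE : E ^+ 2 = 1 - C ^+ 2 by rewrite sqr_sqrtr.
have kN : (0 < k) = false by apply/negbTE; lra.
have ki : k^-1 = - (w^-1) ^+ 2 by rewrite kw invrN exprVn.
have ms s x y : x ^+ 2 + y ^+ 2 = 1 -> model_space k
    (sinh (w * s) * x / w, sinh (w * s) * y / w, cosh (w * s) / w).
  move=> xy; rewrite /model_space kN k0 /lorentz_form /= ki; split; last first.
    by rewrite divr_gt0// (lt_le_trans ltr01)// cosh_ge1.
  have e1 := cosh2Bsinh2 (w * s).
  have e2 : sinh (w * s) ^+ 2 * (x ^+ 2 + y ^+ 2) = sinh (w * s) ^+ 2.
    by rewrite xy mulr1.
  transitivity ((sinh (w * s) ^+ 2 * (x ^+ 2 + y ^+ 2) - cosh (w * s) ^+ 2) *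
    w^-1 ^+ 2); first by ring.
  have -> : sinh (w * s) ^+ 2 * (x ^+ 2 + y ^+ 2) - cosh (w * s) ^+ 2 = -1.
    by rewrite e2; lra.
  by ring.
have md s s' x y x' y' : model_dist k
    (sinh (w * s) * x / w, sinh (w * s) * y / w, cosh (w * s) / w)
    (sinh (w * s') * x' / w, sinh (w * s') * y' / w, cosh (w * s') / w) =
    arcosh (cosh (w * s) * cosh (w * s') -
            sinh (w * s) * sinh (w * s') * (x * x' + y * y')) / w.
  rewrite /model_dist kN k0 -/w /lorentz_form /=; congr (arcosh _ / _).
  by rewrite kw; field; rewrite gt_eqF.
have md0 s r : 0 <= r -> s = cosh (w * r) -> arcosh s / w = r.
  move=> r0 ->; rewrite arcosh_cosh; last by rewrite mulr_ge0// ltW.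
  by rewrite mulrAC divff ?gt_eqF// mul1r.
have cosh00 : cosh 0 = 1 :> R by rewrite cosh_half mul0r sinh0; ring.
exists (sinh (w * 0) * 1 / w, sinh (w * 0) * 0 / w, cosh (w * 0) / w).
exists (sinh (w * a) * 1 / w, sinh (w * a) * 0 / w, cosh (w * a) / w).
exists (sinh (w * b) * C / w, sinh (w * b) * E / w, cosh (w * b) / w).
exists (sinh (w * t) * 1 / w, sinh (w * t) * 0 / w, cosh (w * t) / w).
split; first by split; apply: ms; rewrite ?eE; ring.
split.
  rewrite !md !mulr0 sinh0 cosh00; split.
  - by apply: md0; [exact: ltW|ring].
  - by apply: md0; [exact: ltW|ring].
  - by apply: md0 => //; ring: eC.
rewrite !md !mulr0 sinh0 cosh00.
rewrite !mul1r !mul0r !subr0 !addr0.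
set X := cosh (w * b) * cosh (w * t) - sinh (w * b) * sinh (w * t) * (C * 1).
have X1 : 1 <= X.
  have := cosh_ge1 (w * b - w * t); rewrite coshB.
  have st : 0 <= sinh (w * t) by rewrite sinh_ge0// mulr_ge0// ltW.
  move: sb st C1; rewrite /X mulr1.
  set u := sinh (w * b); set v := sinh (w * t) => u0 v0 C1.
  have : u * v * C <= u * v by rewrite ler_piMr// mulr_ge0// ltW.
  lra.
split.
- by apply: md0.
- by apply: md0; [lra|rewrite mulrBr coshB; ring].
- by rewrite divr_ge0 ?(ltW w0)// arcosh_ge0.
(* The half-angle formula turns every squared half-side into a [cosh]; what remains is the law of
   cosines for [(o, z, y)]. *)
have half s : sinh (w * (s / 2)) ^+ 2 = (cosh (w * s) - 1) / 2.
  by rewrite cosh_half mulrA; field.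
rewrite !half.
have -> : w * (arcosh X / w) = arcosh X by field; rewrite gt_eqF.
rewrite cosh_arcosh//.
have -> : cosh (w * c) = cosh (w * a) * cosh (w * b) -
    C * (sinh (w * a) * sinh (w * b)) by rewrite eC; ring.
rewrite !mulrBr !coshB /X; field.
by rewrite gt_eqF.
Qed.

Lemma euclidean_hinge : model_hinge (0 : R) id 1.
Proof.
move=> a b c t /andP[a0 _] /andP[b0 _] abc cab _ /andP[t0 ta].
have c0 : 0 <= c by rewrite (le_trans _ abc).
set C := (a ^+ 2 + b ^+ 2 - c ^+ 2) / (2 * a * b).
have ab0 : 0 < 2 * a * b by rewrite !mulr_gt0.
have eC : C * (2 * a * b) = a ^+ 2 + b ^+ 2 - c ^+ 2.
  by rewrite divfK// gt_eqF.
have abc2 : (a - b) ^+ 2 <= c ^+ 2.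
  by rewrite -real_normK ?num_real// lerXn2r ?nnegrE.
have C1 : C <= 1 by rewrite -(ler_pM2r ab0) eC; nra.
have CN1 : -1 <= C by rewrite -(ler_pM2r ab0) eC; nra.
have eE : Num.sqrt (1 - C ^+ 2) ^+ 2 = 1 - C ^+ 2.
  by rewrite sqr_sqrtr//; nra.
set E := Num.sqrt (1 - C ^+ 2) in eE.
have md s s' x y x' y' : model_dist 0 (s * x, s * y, 0) (s' * x', s' * y', 0) =
    Num.sqrt ((s * x - s' * x') ^+ 2 + (s * y - s' * y') ^+ 2) :> R.
  by rewrite /model_dist ltxx.
have md0 s r : 0 <= r -> s = r ^+ 2 -> Num.sqrt s = r.
  by move=> r0 ->; rewrite sqrtr_sqr ger0_norm.
exists (0 * 1, 0 * 0, 0), (a * 1, a * 0, 0), (b * C, b * E, 0).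
exists (t * 1, t * 0, 0).
split; first by split; rewrite /model_space ltxx.
split; rewrite !md.
  split; apply: md0; rewrite ?(ltW a0) ?(ltW b0)//.
  - have -> : (b * C - 0 * 1) ^+ 2 + (b * E - 0 * 0) ^+ 2 =
      b ^+ 2 * (C ^+ 2 + E ^+ 2) by ring.
    by rewrite eE; ring.
  - by ring.
  - have -> : (a * 1 - b * C) ^+ 2 + (a * 0 - b * E) ^+ 2 =
      a ^+ 2 - C * (2 * a * b) + b ^+ 2 * (C ^+ 2 + E ^+ 2) by ring.
    by rewrite eE eC; ring.
split.
- by apply: md0; [|ring].
- by apply: md0; [rewrite subr_ge0|ring].
- exact: sqrtr_ge0.
rewrite /= !expr_div_n sqr_sqrtr; last by rewrite addr_ge0 ?sqr_ge0.
have -> : c ^+ 2 = a ^+ 2 + b ^+ 2 - C * (2 * a * b) by rewrite eC; ring.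
have -> : (b * C - t * 1) ^+ 2 + (b * E - t * 0) ^+ 2 =
  t ^+ 2 - C * (2 * t * b) + b ^+ 2 * (C ^+ 2 + E ^+ 2) by ring.
by rewrite eE; field; rewrite gt_eqF.
Qed.

(** Polar coordinates again. The bound by [S] keeps [w * a + w * b] at most 1, hence below [pi]: the
    sines are positive, and [cos] is decreasing where the triangle inequalities are turned into
    [-1 <= C <= 1]. *)
Lemma spherical_hinge k : 0 < k ->
  model_hinge k (fun s => sin (Num.sqrt k * s)) (2^-1 / Num.sqrt k).
Proof.
move=> k0 a b c t /andP[a0 aS] /andP[b0 bS] abc cab cS /andP[t0 ta].
set w := Num.sqrt k in aS bS cS *.
have w0 : 0 < w by rewrite sqrtr_gt0.
have kw : k = w ^+ 2 by rewrite sqr_sqrtr// ltW.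
have c0 : 0 <= c by rewrite (le_trans _ abc).
have pi2 : 2 <= pi :> R by exact: pi_ge2.
have wS x : x <= 2^-1 / w -> w * x <= 2^-1.
  by rewrite ler_pdivlMr// mulrC.
have sin_pos x : 0 < x -> x <= 2^-1 / w -> 0 < sin (w * x).
  move=> x0 /wS xS; apply: sin_gt0_pi; rewrite mulr_gt0//=.
  lra.
have sa := sin_pos _ a0 aS; have sb := sin_pos _ b0 bS.
set C := (cos (w * c) - cos (w * a) * cos (w * b)) /
  (sin (w * a) * sin (w * b)).
have eC : C * (sin (w * a) * sin (w * b)) =
    cos (w * c) - cos (w * a) * cos (w * b).
  by rewrite divfK// mulf_neq0// gt_eqF.
have cos_mono x y : `|x| <= y -> w * y <= pi -> cos (w * y) <= cos (w * x).
  move=> xy yp; rewrite -(cos_norm (w * x)) normrM (gtr0_norm w0).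
  have y0 : 0 <= y by rewrite (le_trans _ xy).
  rewrite leNgt; apply/negP => h.
  move: xy; rewrite leNgt => /negP; apply; rewrite -(ltr_pM2l w0).
  have in0 : w * y \in `[0, pi] by rewrite in_itv/= yp mulr_ge0// ltW.
  rewrite ltNge; apply/negP => xy.
  have in1 : w * `|x| \in `[0, pi].
    by rewrite in_itv/= (le_trans xy yp) mulr_ge0// ltW.
  by move: h; rewrite (ltr_cos in0 in1) ltNge xy.
have C1 : C <= 1.
  rewrite -(ler_pM2r (mulr_gt0 sa sb)) eC mul1r.
  have := cos_mono _ _ abc; rewrite mulrBr cosB => h.
  have : w * c <= pi by have := wS _ cS; lra.
  by move/h; lra.
have CN1 : -1 <= C.
  rewrite -(ler_pM2r (mulr_gt0 sa sb)) eC mulN1r.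
  have := cos_mono c (a + b); rewrite ger0_norm// => /(_ cab).
  rewrite mulrDr cosD => h.
  have : w * a + w * b <= pi by have := wS _ aS; have := wS _ bS; lra.
  by move/h; lra.
have eE : Num.sqrt (1 - C ^+ 2) ^+ 2 = 1 - C ^+ 2.
  by rewrite sqr_sqrtr//; nra.
set E := Num.sqrt (1 - C ^+ 2) in eE.
have ki : k^-1 = (w^-1) ^+ 2 by rewrite kw exprVn.
have ms s x y : x ^+ 2 + y ^+ 2 = 1 -> model_space k
    (sin (w * s) * x / w, sin (w * s) * y / w, cos (w * s) / w).
  move=> xy; rewrite /model_space k0 /euclidean_form /= ki.
  transitivity ((sin (w * s) ^+ 2 * (x ^+ 2 + y ^+ 2) + cos (w * s) ^+ 2) *
    w^-1 ^+ 2); first by ring.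
  by rewrite xy mulr1 addrC cos2Dsin2 mul1r.
have md s s' x y x' y' : model_dist k
    (sin (w * s) * x / w, sin (w * s) * y / w, cos (w * s) / w)
    (sin (w * s') * x' / w, sin (w * s') * y' / w, cos (w * s') / w) =
    acos (cos (w * s) * cos (w * s') +
            sin (w * s) * sin (w * s') * (x * x' + y * y')) / w.
  rewrite /model_dist k0 -/w /euclidean_form /=; congr (acos _ / _).
  by rewrite kw; field; rewrite gt_eqF.
have md0 s r : 0 <= r -> r <= 2^-1 / w -> s = cos (w * r) -> acos s / w = r.
  move=> r0 /wS rS ->; rewrite cosK; last first.
    by rewrite in_itv/= mulr_ge0//= ?(ltW w0)//; lra.
  by rewrite mulrAC divff ?gt_eqF// mul1r.
exists (sin (w * 0) * 1 / w, sin (w * 0) * 0 / w, cos (w * 0) / w).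
exists (sin (w * a) * 1 / w, sin (w * a) * 0 / w, cos (w * a) / w).
exists (sin (w * b) * C / w, sin (w * b) * E / w, cos (w * b) / w).
exists (sin (w * t) * 1 / w, sin (w * t) * 0 / w, cos (w * t) / w).
split; first by split; apply: ms; rewrite ?eE; ring.
split.
  rewrite !md !mulr0 sin0 cos0; split.
  - by apply: md0 => //; [exact: ltW|ring].
  - by apply: md0 => //; [exact: ltW|ring].
  - by apply: md0 => //; ring: eC.
have tS : t <= 2^-1 / w by rewrite (le_trans ta).
rewrite !md !mulr0 sin0 cos0.
rewrite !mul1r !mul0r !addr0.
set X := cos (w * b) * cos (w * t) + sin (w * b) * sin (w * t) * (C * 1).
have st : 0 <= sin (w * t).
  apply: sin_ge0_pi; rewrite mulr_ge0// ?(ltW w0)//=; have := wS _ tS; lra.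
have p0 : 0 <= sin (w * b) * sin (w * t) by rewrite mulr_ge0// ltW.
have X1 : -1 <= X <= 1.
  have := cos_le1 (w * b - w * t); have := cos_geN1 (w * b + w * t).
  rewrite cosB cosD /X mulr1; move: p0 C1 CN1.
  set u := sin (w * b) * sin (w * t) => u0 C1 CN1.
  have : u * C <= u * 1 by rewrite ler_wpM2l.
  have : u * -1 <= u * C by rewrite ler_wpM2l.
  by move=> ? ? ? ?; apply/andP; split; lra.
split.
- by apply: md0.
- apply: md0; [lra|by rewrite (le_trans _ aS)// gerBl|].
  by rewrite mulrBr cosB; ring.
- by rewrite divr_ge0 ?(ltW w0)// acos_ge0.
have half s : sin (w * (s / 2)) ^+ 2 = (1 - cos (w * s)) / 2.
  by rewrite [in RHS]cos_half mulrA; field.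
rewrite !half.
have -> : w * (acos X / w) = acos X by field; rewrite gt_eqF.
rewrite acosK ?in_itv//=.
have -> : cos (w * c) = cos (w * a) * cos (w * b) +
    C * (sin (w * a) * sin (w * b)) by rewrite eC; ring.
rewrite !mulrBr !cosB /X; field.
by rewrite gt_eqF.
Qed.

End hinge.

(** * Contraction towards a point along geodesics *)

Section homothety.
Context {R : realType}.
Implicit Types (M : metricType R) (k S m t l a b c : R) (sn : R -> R).

(** Toponogov comparison with apex [y] and opposite side [gamma] from [p] to [x]: the model distance
    from [y'] to [z'] is at most that from [y] to [gamma t]. The latter is at most [2 * S], so its
    half stays where [sn] is monotone. *)
Lemma curvature_hinge M k sn S m :
  curvature_ge M k -> model_hinge k sn S ->
  (0 < k -> 3 * S < 2 * pi / Num.sqrt k) ->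
  (forall s, 0 <= s <= S -> m * s <= sn s <= 2 * (m * s)) -> 0 <= m ->
  (forall s t, 0 <= s -> s <= t -> t <= S -> sn s <= sn t) ->
  forall (y p x : M) (gamma : R -> M) t, geodesic p x gamma ->
  0 < mdist p x <= S -> 0 < mdist p y <= S -> mdist x y <= S ->
  0 <= t <= mdist p x ->
  sn ((t - mdist p y) / 2) ^+ 2 + sn t / sn (mdist p x) *
    (sn (mdist x y / 2) ^+ 2 - sn ((mdist p x - mdist p y) / 2) ^+ 2)
  <= sn (mdist (gamma t) y / 2) ^+ 2.
Proof.
move=> curv hinge per snb m0 mono y p x gamma t geo pxS pyS xyS tpx.
have tri1 := metric_triangle x p y; have tri2 := metric_triangle p y x.
have tri3 := metric_triangle p x y.
rewrite (metric_sym y x) in tri2; rewrite (metric_sym x p) in tri1.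
have [] := hinge (mdist p x) (mdist p y) (mdist x y) t => //.
  by rewrite ler_norml; apply/andP; split; lra.
move=> o [x' [y' [z' [[mo mx my mz] [[eb ea ec] [et eat e0 <-]]]]]].
have perS : 0 < k -> mdist y p + mdist p x + mdist x y < 2 * pi / Num.sqrt k.
  move=> /per; apply: le_lt_trans; rewrite (metric_sym y).
  by move/andP: pxS => [_ ?]; move/andP: pyS => [_ ?]; lra.
have := @curv y p x gamma geo perS y' o x' z' my mo mx mz.
rewrite (metric_sym y p) => /(_ eb ea ec t tpx et eat).
rewrite (metric_sym y) => le_e.
have g0 : gamma 0 = p by case: geo.
have gt : mdist p (gamma t) = t.
  case: geo => _ _ /(_ 0 t); rewrite lexx mdist_ge0 tpx g0 => -> //.
  by rewrite sub0r normrN ger0_norm//; case/andP: tpx.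
have dS : mdist (gamma t) y <= 2 * S.
  have := metric_triangle (gamma t) p y; rewrite (metric_sym _ p) gt.
  by move/andP: tpx pxS pyS => [_ ?] /andP[_ ?] /andP[_ ?]; lra.
have sn0 s : 0 <= s -> s <= S -> 0 <= sn s.
  move=> s0 sS; have /andP[h _] := snb s (introT andP (conj s0 sS)).
  by rewrite (le_trans _ h)// mulr_ge0.
have eS : mdist (gamma t) y / 2 <= S by lra.
have d0 := mdist_ge0 (gamma t) y.
by rewrite lerXn2r ?nnegrE ?sn0 ?mono// ?divr_ge0 ?ler_pM2r// (le_trans _ eS)//
  ler_pM2r.
Qed.

(** Substituting the first hinge inequality into the second cancels the term in [l * a - b]. With
    [A], [B] the squares of [sn] at [c / 2] and [|a - b| / 2], the square at [d2 / 2] is at least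
    [(l / 2) ^+ 2 * B + (l / 2) ^+ 2 * (A - B)], that is [(l / 2) ^+ 2 * A]. One factor 2 is lost in
    comparing [sn (l * z)] with [l * sn z], another in passing from [sn] back to lengths, whence
    [l / 4]. *)
Lemma hinge_arith sn S m l a b c d1 d2 :
  (forall s, 0 <= s <= S -> m * s <= sn s <= 2 * (m * s)) -> 0 < m ->
  (forall s t, 0 <= s -> s <= t -> t <= S -> sn s <= sn t) ->
  (forall s, sn (- s) = - sn s) ->
  0 < a -> a <= S / 2 -> 0 < b -> b <= S / 2 -> `|a - b| <= c -> c <= S / 2 ->
  0 < l -> l <= 1 -> 0 <= d2 -> d2 <= S ->
  sn ((l * a - b) / 2) ^+ 2 + sn (l * a) / sn a *
    (sn (c / 2) ^+ 2 - sn ((a - b) / 2) ^+ 2) <= sn (d1 / 2) ^+ 2 ->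
  sn ((l * b - l * a) / 2) ^+ 2 + sn (l * b) / sn b *
    (sn (d1 / 2) ^+ 2 - sn ((b - l * a) / 2) ^+ 2) <= sn (d2 / 2) ^+ 2 ->
  l / 4 * c <= d2.
Proof.
move=> snb m0 mono snN a0 aS b0 bS dc cS l0' l1 d20 d2S.
have l0 := ltW l0'; have S0 : 0 < S by lra.
have c0 : 0 <= c by rewrite (le_trans _ dc).
have half z : 0 <= z -> z <= S -> 0 <= z / 2 <= S.
  by move=> z0 zS; apply/andP; split; lra.
have snpos s : 0 < s -> s <= S -> 0 < sn s.
  move=> s0 sS; have /andP[e _] := snb s (introT andP (conj (ltW s0) sS)).
  by rewrite (lt_le_trans _ e)// mulr_gt0.
have snge0 s : 0 <= s <= S -> 0 <= sn s.
  move=> sS; have /andP[h _] := snb s sS; have /andP[s0 _] := sS.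
  by rewrite (le_trans _ h)// mulr_ge0// ltW.
have scale z : 0 <= z <= S -> l / 2 * sn z <= sn (l * z).
  move=> zS; have /andP[z0 z1] := zS.
  have lz0 : 0 <= l * z by rewrite mulr_ge0.
  have lz1 : l * z <= z by rewrite ler_piMl.
  have lz : 0 <= l * z <= S by rewrite lz0 (le_trans lz1).
  have /andP[e1 _] := snb (l * z) lz; have /andP[_ e2] := snb z zS.
  apply: le_trans e1; have : l / 2 * sn z <= l / 2 * (2 * (m * z)).
    by rewrite ler_wpM2l// divr_ge0.
  by move/le_trans; apply; lra.
have ratio z : 0 < z -> z <= S / 2 -> l / 2 <= sn (l * z) / sn z.
  move=> z0 zS; have zS' : z <= S by lra.
  by rewrite ler_pdivlMr ?snpos// scale// zS' ltW.
have sn_even s : sn s ^+ 2 = sn `|s| ^+ 2.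
  by case: (ger0P s) => // _; rewrite snN sqrrN.
have halfnorm (u : R) : `|u / 2| = `|u| / 2.
  by rewrite normrM [`|2^-1|]ger0_norm.
set d := `|a - b| in dc.
have d0 : 0 <= d by rewrite normr_ge0.
have cS' : c <= S by lra.
have hc := half c c0 cS'; have hd := half d d0 (le_trans dc cS').
have hd2 := half d2 d20 d2S.
have AB : sn (d / 2) ^+ 2 <= sn (c / 2) ^+ 2.
  have /andP[d'0 _] := hd; have /andP[_ c'S] := hc.
  by rewrite lerXn2r ?nnegrE ?snge0//; apply: mono => //; rewrite ler_pM2r.
have FB : (l / 2) ^+ 2 * sn (d / 2) ^+ 2 <= sn (l * d / 2) ^+ 2.
  have h := scale _ hd; have h0 : 0 <= l / 2 * sn (d / 2).
    by rewrite mulr_ge0 ?divr_ge0 ?snge0.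
  by rewrite -exprMn -mulrA lerXn2r ?nnegrE ?(le_trans h0 h).
have fin : l / 2 * sn (c / 2) <= sn (d2 / 2) -> l / 4 * c <= d2.
  have /andP[h1 _] := snb _ hc; have /andP[_ h2] := snb _ hd2.
  have h3 : l / 2 * (m * (c / 2)) <= l / 2 * sn (c / 2).
    by rewrite ler_wpM2l// divr_ge0.
  move=> h; rewrite -(ler_pM2l m0).
  by clear -h h2 h3; lra.
have pos1 : 0 <= l / 2 * sn (c / 2) by rewrite mulr_ge0 ?divr_ge0 ?snge0.
have pos2 := snge0 _ hd2.
have Q1 := ratio a a0 aS; have Q2 := ratio b b0 bS.
have eB : sn ((a - b) / 2) ^+ 2 = sn (d / 2) ^+ 2.
  by rewrite sn_even halfnorm.
have eT : sn ((b - l * a) / 2) ^+ 2 = sn ((l * a - b) / 2) ^+ 2.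
  by rewrite sn_even [RHS]sn_even !halfnorm distrC.
have eF : sn ((l * b - l * a) / 2) ^+ 2 = sn (l * d / 2) ^+ 2.
  by rewrite sn_even halfnorm -mulrBr normrM (ger0_norm l0) distrC.
rewrite eB eT eF => I1 I2; apply: fin.
rewrite -ler_sqr ?nnegrE// exprMn.
have l2 : 0 <= l / 2 by rewrite divr_ge0.
move: I1 I2 AB FB Q1 Q2 l2; clear.
set q1 := sn (l * a) / sn a; set q2 := sn (l * b) / sn b.
set A := sn (c / 2) ^+ 2; set B := sn (d / 2) ^+ 2.
move=> I1 I2 AB FB Q1 Q2 l2.
have qAB : (l / 2) ^+ 2 * (A - B) <= q2 * q1 * (A - B).
  by rewrite ler_wpM2r ?subr_ge0// expr2 ler_pM.
have := ler_wpM2l (le_trans l2 Q2) I1.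
lra.
Qed.

(** The hinge inequality is applied twice: [x] moves to [x1] while [y] is fixed, then [y] moves to
    [y1] while [x1] is fixed. The hypotheses use [S / 2] so that the new distances, estimated
    through [p], are still at most [S]. *)
Lemma homothety_of_hinge M k sn S m :
  curvature_ge M k -> model_hinge k sn S ->
  (0 < k -> 3 * S < 2 * pi / Num.sqrt k) ->
  (forall s, 0 <= s <= S -> m * s <= sn s <= 2 * (m * s)) -> 0 < m ->
  (forall s t, 0 <= s -> s <= t -> t <= S -> sn s <= sn t) ->
  (forall s, sn (- s) = - sn s) ->
  forall (p x y : M) (g h : R -> M) l, geodesic p x g -> geodesic p y h ->
  mdist p x <= S / 2 -> mdist p y <= S / 2 -> mdist x y <= S / 2 ->
  0 <= l <= 1 ->
  l / 4 * mdist x y <= mdist (g (l * mdist p x)) (h (l * mdist p y)).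
Proof.
move=> curv hinge per snb m0 mono snN p x y g h l gg gh pxS pyS xyS /andP[l0 l1].
have dist_start z (e : R -> M) : geodesic p z e -> forall t, 0 <= t <= mdist p z ->
    mdist p (e t) = t.
  move=> [e0 _ ee] t ht; have := ee 0 t; rewrite lexx mdist_ge0 e0 => -> //.
  by rewrite sub0r normrN ger0_norm//; case/andP: ht.
have shrink (z : M) : 0 <= l * mdist p z <= mdist p z.
  by rewrite mulr_ge0 ?mdist_ge0// ler_piMl ?mdist_ge0.
have gp := dist_start _ _ gg _ (shrink x).
have hp := dist_start _ _ gh _ (shrink y).
(* In a degenerate hinge one geodesic is constant at [p], and the claim reduces to [l / 4 <= l]. *)
have [px0|px0] := eqVneq (mdist p x) 0.
  have px : p = x by exact: mdist_positivity.
  have -> : g (l * mdist p x) = p.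
    by rewrite px0 mulr0; case: gg.
  by rewrite hp -px ler_wpM2r ?mdist_ge0//; lra.
have [py0|py0] := eqVneq (mdist p y) 0.
  have py : p = y by exact: mdist_positivity.
  have -> : h (l * mdist p y) = p.
    by rewrite py0 mulr0; case: gh.
  by rewrite [leRHS]metric_sym gp -py (metric_sym x) ler_wpM2r ?mdist_ge0//; lra.
have a0 : 0 < mdist p x by rewrite lt_neqAle eq_sym px0 mdist_ge0.
have b0 : 0 < mdist p y by rewrite lt_neqAle eq_sym py0 mdist_ge0.
have S0 : 0 < S by lra.
set x1 := g _ in gp *; set y1 := h _ in hp *.
have hinge1 := @curvature_hinge M k sn S m curv hinge per snb (ltW m0) mono.
have d1S : mdist x1 y <= S.
  have := metric_triangle x1 p y; rewrite (metric_sym x1 p) gp.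
  by have /andP[_] := shrink x; lra.
have d2S : mdist x1 y1 <= S.
  have := metric_triangle x1 p y1; rewrite (metric_sym x1 p) gp hp.
  by have /andP[_] := shrink x; have /andP[_] := shrink y; lra.
have [l00|lN0] := eqVneq l 0; first by rewrite l00 !mul0r mdist_ge0.
have lp : 0 < l by rewrite lt_neqAle eq_sym lN0.
have I1 : sn ((l * mdist p x - mdist p y) / 2) ^+ 2 +
    sn (l * mdist p x) / sn (mdist p x) *
    (sn (mdist x y / 2) ^+ 2 - sn ((mdist p x - mdist p y) / 2) ^+ 2)
    <= sn (mdist x1 y / 2) ^+ 2.
  by apply: hinge1; rewrite ?a0 ?b0 ?shrink//=; lra.
have I2 : sn ((l * mdist p y - l * mdist p x) / 2) ^+ 2 +
    sn (l * mdist p y) / sn (mdist p y) *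
    (sn (mdist x1 y / 2) ^+ 2 - sn ((mdist p y - l * mdist p x) / 2) ^+ 2)
    <= sn (mdist x1 y1 / 2) ^+ 2.
  rewrite -{1 2}gp (metric_sym x1 y) (metric_sym x1 y1).
  apply: hinge1; rewrite ?gp ?b0 ?(metric_sym y) ?shrink//=; first lra.
  by rewrite mulr_gt0//=; have /andP[_] := shrink x; lra.
apply: (hinge_arith sn S m l (mdist p x) (mdist p y) (mdist x y) (mdist x1 y)
  (mdist x1 y1)) => //; last exact: mdist_ge0.
have tri2 := metric_triangle p y x; have tri3 := metric_triangle p x y.
  rewrite (metric_sym y x) in tri2.
  by rewrite ler_norml; apply/andP; split; lra.
Qed.

End homothety.

Section alexandrov_homothety.
Context {R : realType}.

(** The factor 1/4 makes one statement serve all signs of the curvature; only its independence of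
    [l] matters for the self-similarity argument. *)
Definition homothety_bound (M : metricType R) (S : R) :=
  forall (p x y : M) (g h : R -> M) (l : R), geodesic p x g -> geodesic p y h ->
  mdist p x <= S -> mdist p y <= S -> mdist x y <= S -> 0 <= l <= 1 ->
  l / 4 * mdist x y <= mdist (g (l * mdist p x)) (h (l * mdist p y)).

Lemma curvature_homothety_bound (k : R) : exists2 S : R, 0 < S <= 1 &
  forall M : metricType R, curvature_ge M k -> homothety_bound M S.
Proof.
suff [S S0 HS] : exists2 S : R, 0 < S &
    forall M : metricType R, curvature_ge M k -> homothety_bound M S.
  (* Shrinking [S] only restricts the triples considered; [S <= 1] serves later to bound the mesh of
     the nets. *)
  exists (Num.min S 1); first by rewrite lt_min S0 ltr01 ge_min lexx orbT.
  move=> M /HS H p x y g h l gg gh; rewrite !le_min.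
  by move=> /andP[? _] /andP[? _] /andP[? _]; exact: H.
have [k0|k0|->] := ltgtP k 0.
- set w := Num.sqrt (- k); have w0 : 0 < w by rewrite sqrtr_gt0; lra.
  exists (2^-1 / w / 2); first by rewrite !divr_gt0.
  move=> M curv p x y g h l.
  apply: (@homothety_of_hinge R M k (fun s => sinh (w * s)) (2^-1 / w)
    (w * (3 / 4))) => //.
  + exact: hyperbolic_hinge.
  + by move=> ?; lra.
  + move=> s; rewrite ler_pdivlMr// => /andP[s0 s1].
    have -> : w * (3 / 4) * s = 3 / 4 * (w * s) by ring.
    by apply: sinh_bounds; rewrite mulr_ge0 ?(ltW w0)//= mulrC.
  + by rewrite mulr_gt0.
  + by move=> s t _ st _; rewrite le_sinh// ler_pM2l.
  + by move=> s; rewrite mulrN sinhN.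
- set w := Num.sqrt k; have w0 : 0 < w by rewrite sqrtr_gt0.
  have pi2 := @pi_ge2 R.
  exists (2^-1 / w / 2); first by rewrite !divr_gt0.
  move=> M curv p x y g h l.
  apply: (@homothety_of_hinge R M k (fun s => sin (w * s)) (2^-1 / w)
    (w / 2)) => //.
  + exact: spherical_hinge.
  + by move=> _; rewrite -/w mulrA ltr_pM2r ?invr_gt0//; lra.
  + move=> s; rewrite ler_pdivlMr// => /andP[s0 s1].
    have -> : w / 2 * s = 2^-1 * (w * s) by ring.
    by apply: sin_bounds; rewrite mulr_ge0 ?(ltW w0)//= mulrC.
  + by rewrite divr_gt0.
  + move=> s t s0 st; rewrite ler_pdivlMr// mulrC => tS.
    have ws0 : 0 <= w * s by rewrite mulr_ge0// ltW.
    have wst : w * s <= w * t by rewrite ler_pM2l.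
    rewrite leNgt ltr_sin ?in_itv/= -?leNgt//; apply/andP; split; lra.
  + by move=> s; rewrite mulrN sinN.
- exists (1 / 2); first by rewrite divr_gt0.
  move=> M curv p x y g h l.
  apply: (@homothety_of_hinge R M 0 id 1 1) => //.
  + exact: euclidean_hinge.
  + by rewrite ltxx.
  + by move=> s /andP[s0 _] /=; rewrite mul1r lexx/= mulr_natl mulr2n lerDl.
Qed.

End alexandrov_homothety.

(** * Packings and Hausdorff dimension *)

Section cantor_descent.
Context {R : realType} {M : metricType R}.
Implicit Types (S rho s : R) (p x : M).

Definition meets (A : set M) p (r : R) : Prop :=
  exists x, A x /\ mdist p x <= r.

(** A stand-in for the mass of a closed ball: the total weight of the members of the cover that
    touch it. *)
Definition load (U : nat -> set M) (v : nat -> R) p (r : R) : \bar R :=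
  (\sum_(i <oo) (if `[< meets (U i) p r >] then v i else 0)%:E)%E.

Lemma le_load U v p r i : (forall i, 0 < v i) -> meets (U i) p r ->
  ((v i)%:E <= load U v p r)%E.
Proof.
move=> v0 mi; rewrite /load.
have := @nneseries_lim_ge R (fun i =>
  (if `[< meets (U i) p r >] then v i else 0)%:E) xpredT 0%N i.+1.
have ge0 j : (0 <= (if `[< meets (U j) p r >] then v j else 0)%:E)%E.
  by rewrite lee_fin; case: ifP => // _; exact: ltW.
move=> /(_ (fun j _ _ => ge0 j)); apply: le_trans.
rewrite big_mkord big_ord_recr /= asboolT// leeDr//.
by apply: sume_ge0 => j _; exact: ge0.
Qed.

(** A member of the cover that meets the big ball weighs less than [t], so it is smaller than
    [2 * r']. Two distinct children are at least [2 * r'] apart, so it meets at most one of them,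
    and the loads compare term by term. *)
Lemma load_children U v p r r' t K (q : 'I_K -> M) :
  (forall i, 0 < v i) -> (load U v p r < t%:E)%E ->
  (forall i a b, v i < t -> U i a -> U i b -> mdist a b < 2 * r') ->
  (forall j, mdist p (q j) + r' <= r) ->
  (forall i j, i != j -> 4 * r' <= mdist (q i) (q j)) ->
  (\sum_(j < K) load U v (q j) r' <= load U v p r)%E.
Proof.
move=> v0 pt Usmall qp qsep; rewrite /load.
rewrite -(@nneseries_sum _ _ xpredT R (fun j i =>
  (if `[< meets (U i) (q j) r' >] then v i else 0)%:E)); last first.
  by move=> j i _; rewrite lee_fin; case: ifP => // _; exact: ltW.
apply: lee_nneseries => [i _ _|i _].
  by apply: sume_ge0 => j _; rewrite lee_fin; case: ifP => // _; exact: ltW.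
rewrite sumEFin lee_fin.
have [[j mj]|nm] := pselect (exists j, meets (U i) (q j) r'); last first.
  rewrite big1 => [|j _].
    by case: ifP => // _; exact: ltW.
  by rewrite asboolF// => mj; apply: nm; exists j.
have mp : meets (U i) p r.
  have [x [Ux qx]] := mj; exists x; split=> //.
  by rewrite (le_trans (metric_triangle p (q j) x))// (le_trans _ (qp j))// lerD2l.
have vt : v i < t by rewrite -lte_fin (le_lt_trans _ pt)// le_load.
rewrite (asboolT mp) (bigD1 j)//= (asboolT mj) big1 ?addr0// => j' jj'.
rewrite asboolF// => -[y [Uy qy]]; have [x [Ux qx]] := mj.
have := Usmall i x y vt Ux Uy; have := qsep j j'; rewrite eq_sym => /(_ jj').
have := metric_triangle (q j) x y; have := metric_triangle (q j) y (q j').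
by rewrite (metric_sym y (q j')); lra.
Qed.

(** The point is a cluster point of the centers: each closed ball contains all later centers, so a
    cluster point cannot lie outside it. *)
Lemma nested_balls_cluster (p : nat -> M) (r : nat -> R) :
  compact [set: M] -> (forall m, 0 <= r m) ->
  (forall m, mdist (p m) (p m.+1) + r m.+1 <= r m) ->
  exists x, forall m, mdist (p m) x <= r m.
Proof.
move=> cpt r0 step.
have nest m j : mdist (p m) (p (m + j)%N) + r (m + j)%N <= r m.
  elim: j => [|j IH]; first by rewrite addn0 mdistxx add0r.
  apply: le_trans IH; rewrite addnS.
  have := step (m + j)%N; have := metric_triangle (p m) (p (m + j)%N) (p (m + j).+1).
  lra.
have [x [_ xcl]] := cpt (p @ \oo) _ (filterT : (p @ \oo) setT).
exists x => m; rewrite leNgt; apply/negP => h.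
have [] := xcl [set y | mdist (p m) y <= r m] (ball x (mdist (p m) x - r m)).
- exists m => // j /= mj; have := nest m (j - m)%N; rewrite subnKC// => hh.
  by have := r0 j; lra.
- by apply: nbhsx_ballx; rewrite subr_gt0.
move=> y [/= py]; rewrite ballEmdist /=.
have := metric_triangle (p m) y x; rewrite (metric_sym y x); lra.
Qed.

(* No measure on the Cantor set is needed: as 1 <= K rho^s, some child of a ball
   with load less than (S rho^(m+1))^s has load less than (S rho^(m+2))^s, and the
   limit of the balls chosen in this way cannot be covered. *)
Lemma cantor_descent S rho s K x0 U u :
  compact [set: M] -> 0 < S -> 0 < rho <= 2^-1 -> 0 < s ->
  1 <= K%:R * rho `^ s ->
  (forall p r, mdist x0 p + r <= S / 2 -> 0 < r ->
    exists q : 'I_K -> M, (forall j, mdist p (q j) <= r / 2) /\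
      (forall i j, i != j -> 4 * (rho * r) <= mdist (q i) (q j))) ->
  (forall i, 0 < u i) -> (forall i a b, U i a -> U i b -> mdist a b <= u i) ->
  (forall x : M, exists i, U i x) ->
  ~ (\sum_(i <oo) (u i `^ s)%:E < ((S * rho) `^ s)%:E)%E.
Proof.
move=> cpt S0 /andP[rho0 rho1] s0 Krho children u0 Uu cov sum.
pose r m := S / 2 * rho ^+ m.
have r0 m : 0 < r m by rewrite mulr_gt0 ?exprn_gt0 ?divr_gt0.
have rS m : r m.+1 <= r m / 2.
  by rewrite /r exprS mulrCA mulrC ler_pM2l ?(r0 m).
(* As [S * rho ^+ m.+1] equals [2 * r m.+1], a set of weight below [t m] is small enough for
   [load_children]. *)
pose t m := (S * rho ^+ m.+1) `^ s.
have Sr0 m : 0 < S * rho ^+ m by rewrite mulr_gt0 ?exprn_gt0.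
pose v i := u i `^ s.
have v0 i : 0 < v i by rewrite powR_gt0.
have vt i m : v i < t m -> u i < S * rho ^+ m.+1.
  move=> h; rewrite ltNge; apply/negP => h'; move: h; rewrite ltNge => /negP; apply.
  by apply: ge0_ler_powR => //; rewrite ?nnegrE ltW.
pose good m p := mdist x0 p + r m <= S / 2 /\ (load U v p (r m) < (t m)%:E)%E.
have good0 : good 0%N x0.
  split; first by rewrite mdistxx add0r /r expr0 mulr1.
  rewrite /t expr1; apply: le_lt_trans sum; apply: lee_nneseries => i _.
    by move=> _; rewrite lee_fin; case: ifP => // _; exact: ltW.
  by rewrite lee_fin; case: ifP => // _; exact: powR_ge0.
have good_step m p : good m p ->
    exists q, good m.+1 q /\ mdist p q + r m.+1 <= r m.
  move=> [pm lp]; have [q [qp qsep]] := children p (r m) pm (r0 m).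
  have er : rho * r m = r m.+1 by rewrite /r exprS mulrCA.
  rewrite er in qsep.
  have qpr j : mdist p (q j) + r m.+1 <= r m.
    by rewrite (le_trans (lerD (qp j) (rS m)))//; lra.
  have tm : (t m <= K%:R * t m.+1).
    rewrite /t (exprSr _ m.+1) mulrA [in leRHS]powRM ?(ltW rho0) ?(ltW (Sr0 _))//.
    by rewrite mulrCA ler_peMr// powR_ge0.
  have small i a b : v i < t m -> U i a -> U i b -> mdist a b < 2 * r m.+1.
    move=> /vt h Ua Ub; apply: le_lt_trans (Uu _ _ _ Ua Ub) _.
    by apply: (lt_le_trans h); rewrite /r; lra.
  have le_sum := @load_children U v p (r m) (r m.+1) (t m) K q v0 lp small qpr qsep.
  have [[j lj]|nj] := pselect (exists j, (load U v (q j) (r m.+1) < (t m.+1)%:E)%E).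
    exists (q j); split=> //; split=> //.
    rewrite (le_trans _ pm)//; have := metric_triangle x0 p (q j).
    have := qpr j; lra.
  (* Otherwise the children would carry at least [K%:R * t m.+1], which is at least [t m] and
     exceeds the load of the parent. *)
  exfalso; move: le_sum; apply/negP; rewrite -ltNge.
  apply: (lt_le_trans lp); apply: (@le_trans _ _ (\sum_(j < K) (t m.+1)%:E)%E).
    by rewrite sumEFin sumr_const card_ord lee_fin -mulr_natl.
  apply: lee_sum => j _; rewrite leNgt; apply/negP => h.
  by apply: nj; exists j.
have /choice[f fP] : forall mp : nat * M, exists q, good mp.1 mp.2 ->
    good mp.1.+1 q /\ mdist mp.2 q + r mp.1.+1 <= r mp.1.
  move=> [m p]; have [g|ng] := pselect (good m p).
    by have [q hq] := good_step m p g; exists q.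
  by exists p.
pose p := nat_rect (fun=> M) x0 (fun m x => f (m, x)).
have gp m : good m (p m).
  by elim: m => [|m IH] //=; have [] := fP (m, p m) IH.
have [x px] := nested_balls_cluster p r cpt (fun m => ltW (r0 m))
  (fun m => (fP (m, p m) (gp m)).2).
have [i Uix] := cov x.
(* The set [U i] contains [x], so it meets every chosen ball, and its weight is below every
   threshold; this forces [u i] under a sequence tending to 0. *)
have ui m : u i < S * rho ^+ m.+1.
  apply: vt; have [_] := gp m; rewrite -lte_fin; apply: le_lt_trans.
  by apply: le_load => //; exists x.
have : (fun m => S * rho ^+ m) @ \oo --> (0 : R).
  rewrite -[X in _ --> X](mulr0 S); apply: cvgMr; apply: cvg_expr.
  by rewrite ger0_norm ?(ltW rho0)//; lra.
move/cvgrPdist_lt => /(_ _ (u0 i)) [m _ hm].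
have := hm m.+1 (leqnSn m); rewrite /= sub0r normrN gtr0_norm//.
by move/(lt_trans (ui m)); rewrite ltxx.
Qed.

End cantor_descent.

(** * Packing bound from the Hausdorff dimension *)

Section packing.
Context {R : realType}.
Implicit Types (M : metricType R) (S e s : R).

Lemma le_diam M (A : set M) x y : A x -> A y -> ((mdist x y)%:E <= diam A)%E.
Proof.
move=> Ax Ay; rewrite /diam le_max; apply/orP; right.
by apply: ereal_sup_ubound; exists (x, y).
Qed.

(** The sizes [u i] must be positive, even for sets of zero diameter, so a summable geometric term
    is added to [d i] to the power [s] before the root is taken. Half of [eta] pays for the cover, a
    quarter for these terms. *)
Lemma hausdorff_null_cover M s (eta : R) :
  0 < s -> hausdorff_measure s [set: M] = 0%E -> 0 < eta ->
  exists (U : nat -> set M) (u : nat -> R),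
    [/\ forall i, 0 < u i, forall i a b, U i a -> U i b -> mdist a b <= u i,
      forall x, exists i, U i x & (\sum_(i <oo) (u i `^ s)%:E < eta%:E)%E].
Proof.
move=> s0 h0 eta0.
(* Scale 1 also makes the diameters finite, so that [fine] loses nothing. *)
have : (hausdorff_content s 1 [set: M] < (eta / 2)%:E)%E.
  apply: (@le_lt_trans _ _ 0%E); last by rewrite lte_fin divr_gt0.
  by rewrite -h0; apply: ereal_sup_ubound; exists 1 => //=.
move=> /ereal_inf_lt[_ [U [cov Ud] <-] Ulo].
have diam0 i : (0 <= diam (U i))%E by rewrite /diam le_max lexx.
have diamfin i : diam (U i) \is a fin_num.
  by rewrite ge0_fin_numE// (le_lt_trans (Ud i))// ltry.
pose d i := fine (diam (U i)).
have d0 i : 0 <= d i by rewrite fine_ge0.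
pose w i := d i `^ s + (eta / 2 / 2) / (2 ^ i.+1)%:R.
have w0 i : 0 < w i.
  by rewrite ltr_wpDl ?powR_ge0// !divr_gt0// ltr0n expn_gt0.
have uK i : (w i `^ s^-1) `^ s = w i.
  by rewrite -powRrM mulVf ?gt_eqF// powRr1// ltW.
exists U, (fun i => w i `^ s^-1); split.
- by move=> i; rewrite powR_gt0.
- move=> i a b Ua Ub; rewrite (@le_trans _ _ (d i))//.
    by rewrite -lee_fin fineK// le_diam.
  have -> : d i = (d i `^ s) `^ s^-1.
    by rewrite -powRrM mulfV ?gt_eqF// powRr1.
  apply: ge0_ler_powR; rewrite ?nnegrE ?invr_ge0 ?powR_ge0 ?(ltW s0) ?(ltW (w0 _))//.
  by rewrite lerDl ltW// !divr_gt0// ltr0n expn_gt0.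
- by move=> x; have [i _ Ux] := cov x I; exists i.
apply: (@le_lt_trans _ _ ((\sum_(i <oo) poweR (diam (U i)) s) + (eta / 2 / 2)%:E)%E).
  have := @epsilon_trick R (fun i => poweR (diam (U i)) s) (eta / 2 / 2) xpredT.
  move=> /(_ (fun n => poweR_ge0 _ _)) h; apply: le_trans (h _); last first.
    by rewrite !divr_ge0// ltW.
  apply: lee_nneseries => [i _ _|i _]; first by rewrite lee_fin powR_ge0.
  by rewrite uK /w EFinD -poweR_EFin /d fineK.
have -> : eta%:E = ((eta / 2)%:E + (eta / 2)%:E)%E by rewrite -EFinD -splitr.
apply: (@lte_leD _ _ _ _ _ _) => //.
by rewrite lee_fin ler_pdivrMr//; lra.
Qed.

Definition sep M e : seq M -> bool := pairwise (fun x y => e <= mdist x y).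

Lemma sep_nth M e (s : seq M) x0 i j : sep M e s ->
  (i < size s)%N -> (j < size s)%N -> i != j ->
  e <= mdist (nth x0 s i) (nth x0 s j).
Proof.
move=> /(pairwiseP x0) h si sj; rewrite neq_ltn => /orP[ij|ji].
  exact: h.
by rewrite metric_sym; exact: h.
Qed.

(** If there were more points than claimed, [K%:R * rho ^+ n] would exceed 1, and some exponent [s']
    of null measure would still satisfy [1 <= K%:R * rho] to the power [s']. Copies of the [K]
    points, contracted towards the center of an arbitrary small ball, then serve as children in
    [cantor_descent]. *)
Lemma ball_packing M S e n (x0 : M) (s : seq M) :
  compact [set: M] -> geodesic_space M -> homothety_bound M S ->
  hausdorff_dim [set: M] = n%:R%:E -> 0 < e -> e <= S ->
  (forall q, q \in s -> mdist x0 q <= S / 2) -> sep M e s ->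
  (size s)%:R <= (32 * S / e) ^+ n.
Proof.
move=> cpt geo homo dim e0 eS sB ssep; have S0 : 0 < S by lra.
rewrite leNgt; apply/negP => big.
(* Contraction by [l = r / (2 * S)] leaves a separation of [l / 4 * e = r * e / (8 * S)], which has
   to be [4 * (rho * r)]. *)
pose rho := e / (32 * S).
have rho0 : 0 < rho by rewrite divr_gt0// mulr_gt0.
have rho1 : rho <= 2^-1 by rewrite ler_pdivrMr ?mulr_gt0//; lra.
have rhoV : 32 * S / e = rho^-1 by rewrite invf_div.
set K := size s in big.
have bigK : 1 < K%:R * rho ^+ n.
  by rewrite -ltr_pdivrMr ?exprn_gt0// mul1r -exprVn -rhoV.
have K0 : (0 : R) < K%:R.
  by rewrite ltr0n lt0n; apply/eqP => K0; move: bigK; rewrite K0 mul0r ltr10.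
have lnrho : ln rho < 0 by rewrite ln_lt0// rho0/=; lra.
have lnbig : 0 < ln (K%:R : R) + n%:R * ln rho.
  have := bigK; rewrite -ltr_ln ?posrE ?mulr_gt0 ?exprn_gt0// ln1.
  by rewrite lnM ?posrE ?exprn_gt0// lnXn// mulr_natl.
have [_ [s' [s'0 meas0] <-]] : exists2 y : \bar R,
    [set s%:E | s in [set s : R | 0 < s /\ hausdorff_measure s [set: M] = 0%E]] y &
    (y < (ln (K%:R : R) / - ln rho)%:E)%E.
  apply: ereal_inf_lt; rewrite -/(hausdorff_dim _) dim lte_fin.
  by rewrite ltr_pdivlMr ?oppr_gt0//; lra.
rewrite lte_fin ltr_pdivlMr ?oppr_gt0// => s'lt.
have Krho : 1 <= K%:R * rho `^ s'.
  rewrite -ler_ln ?posrE ?mulr_gt0 ?powR_gt0// ln1 lnM ?posrE ?powR_gt0//.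
  by rewrite ln_powR; lra.
have [U [u [u0 Uu cov sum]]] := hausdorff_null_cover M s' ((S * rho) `^ s') s'0 meas0
  (powR_gt0 _ (mulr_gt0 S0 rho0)).
apply: (@cantor_descent R M S rho s' K x0 U u) => //; first by rewrite rho0.
move=> p r pr r0.
have pS : mdist x0 p <= S / 2 by lra.
have rS : r <= S / 2 by have := mdist_ge0 x0 p; lra.
pose l := r / (2 * S).
have l0 : 0 < l by rewrite divr_gt0// mulr_gt0.
have l1 : l <= 1 by rewrite ler_pdivrMr ?mulr_gt0//; lra.
have lS : l * S = r / 2 by rewrite /l; field; rewrite gt_eqF.
have [g gP] := choice (fun x => geo p x).
pose x (j : 'I_K) := nth p s j.
have xin j : x j \in s by rewrite mem_nth.
have xS j : mdist p (x j) <= S.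
  have := metric_triangle p x0 (x j); rewrite (metric_sym p x0).
  by have := sB _ (xin j); lra.
exists (fun j => g (x j) (l * mdist p (x j))); split=> [j|i j ij].
  have [g0 _ ee] := gP (x j).
  have in0 : 0 <= l * mdist p (x j) <= mdist p (x j).
    by rewrite mulr_ge0 ?mdist_ge0 ?(ltW l0)//= ler_piMl ?mdist_ge0.
  have in1 : (0 : R) <= 0 <= mdist p (x j) by apply/andP; split; [exact: lexx|exact: mdist_ge0].
  have := ee _ _ in1 in0; rewrite g0 => ->.
  rewrite sub0r normrN ger0_norm; last by case/andP: in0.
  by rewrite -lS ler_pM2l.
have xx : mdist (x i) (x j) <= S.
  have := metric_triangle (x i) x0 (x j); rewrite (metric_sym (x i) x0).
  by have := sB _ (xin i); have := sB _ (xin j); lra.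
apply: le_trans (homo p (x i) (x j) _ _ l (gP _) (gP _) (xS i) (xS j) xx _);
  last by rewrite (ltW l0).
have -> : 4 * (rho * r) = l / 4 * e by rewrite /rho /l; field; rewrite gt_eqF.
have l4 : 0 <= l / 4 by lra.
rewrite ler_wpM2l//.
exact: (@sep_nth M e s p i j ssep (ltn_ord i) (ltn_ord j) ij).
Qed.

End packing.

(** * Nets *)

Section covering.
Context {R : realType}.
Implicit Types (M : metricType R) (S e b : R).

Definition net M e (A : set M) (s : seq M) :=
  forall x, A x -> exists2 q, q \in s & mdist q x < e.
Arguments net {M}.

(** A separated list of maximal length is a net, since a point far from all its members could be
    added to it. The bound [b] on the lengths yields the maximum. *)
Lemma exists_maximal_sep M e b (A : set M) :
  (forall s : seq M, (forall q, q \in s -> A q) -> sep M e s -> (size s)%:R <= b) ->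
  exists2 s : seq M, (size s)%:R <= b & net e A s.
Proof.
move=> bnd; pose P n := `[< exists s : seq M,
  [/\ forall q, q \in s -> A q, sep M e s & size s = n] >].
have exP : exists n, P n by exists 0%N; apply/asboolP; exists [::].
have leP n : P n -> (n <= Num.bound b)%N.
  move=> /asboolP[s [sA ssep <-]]; have h := bnd s sA ssep.
  have b0 : 0 <= b by rewrite (le_trans _ h).
  by rewrite -(ler_nat R) (le_trans h)// ltW// archi_boundP.
case: (ex_maxnP exP leP) => N /asboolP[s [sA ssep sN]] maxN.
exists s; first exact: bnd.
move=> x Ax; have [|nq] := pselect (exists2 q, q \in s & mdist q x < e); first by [].
have : P N.+1.
  apply/asboolP; exists (x :: s); split=> /=; last by rewrite sN.
    by move=> q; rewrite inE => /predU1P[->//|]; exact: sA.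
  rewrite /sep /= -/(sep _ _ _) ssep andbT; apply/allP => q qs.
  by rewrite leNgt; apply/negP => h; apply: nq; exists q; rewrite // metric_sym.
by move/maxN; rewrite ltnn.
Qed.

Lemma size_flatten_le (T T' : Type) b (f : T -> seq T') (s : seq T) :
  (forall q, (size (f q))%:R <= b) ->
  (size (flatten [seq f q | q <- s]))%:R <= (size s)%:R * b.
Proof.
move=> fb; elim: s => [|q s IH] /=; first by rewrite mul0r.
by rewrite size_cat natrD -addn1 natrD addrC mulrDl mul1r lerD.
Qed.

Section homothety_space.
Variables (M : metricType R) (S : R) (n : nat).
Hypotheses (cpt : compact [set: M]) (geo : geodesic_space M).
Hypotheses (homo : homothety_bound M S).
Hypotheses (dim : hausdorff_dim [set: M] = n%:R%:E) (S0 : 0 < S).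

Lemma ball_net e (x0 : M) : 0 < e -> e <= S ->
  exists2 s : seq M, (size s)%:R <= (32 * S / e) ^+ n &
    net e [set x | mdist x0 x <= S / 2] s.
Proof.
move=> e0 eS; apply: exists_maximal_sep => s sA ssep.
exact: (@ball_packing R M S e n x0 s).
Qed.

(** Induction on the number of steps of length [S / 4]. Going back along a geodesic to [x0] by at
    most one step reaches a point within [S / 8] of the previous net, so [x] is within [S / 2] of a
    net point, around which [ball_net] supplies at most [256 ^+ n] points. *)
Lemma chain_net (x0 : M) j :
  exists2 s : seq M, (size s)%:R <= (256 ^+ n) ^+ j :> R &
    net (S / 8) [set x | mdist x0 x <= j%:R * (S / 4)] s.
Proof.
elim: j => [|j [s sz snet]].
  exists [:: x0]; rewrite ?expr0// => x; rewrite /= mul0r => x0x.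
  by exists x0; rewrite ?inE// (le_lt_trans x0x)// divr_gt0.
have S8 : S / 8 <= S by move: S0; lra.
have [f fP] := choice (fun q => (exists2P _ _).1 (ball_net (S / 8) q (divr_gt0 S0 (ltr0n _ 8)) S8)).
exists (flatten [seq f q | q <- s]).
  rewrite exprSr; apply: (le_trans (size_flatten_le _ _ (256 ^+ n) _ _ _)).
    move=> q; have [h _] := fP q; apply: (le_trans h).
    have -> : 32 * S / (S / 8) = 256 by field; rewrite gt_eqF.
    by [].
  by rewrite ler_wpM2r// exprn_ge0.
move=> x /=; set d := mdist x0 x => dj.
have [g [g0 gd gg]] := geo x0 x.
pose t := Num.min d (j%:R * (S / 4)).
have t0 : 0 <= t by rewrite le_min mdist_ge0 mulr_ge0// divr_ge0// ltW.
have td : t <= d by rewrite ge_min lexx.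
have tj : t <= j%:R * (S / 4) by rewrite ge_min lexx orbT.
have dt : d - t <= S / 4.
  move: dj; rewrite -addn1 natrD mulrDl mul1r => dj.
  rewrite /t; case: (leP d (j%:R * (S / 4))) => _; last by lra.
  by rewrite subrr divr_ge0// ltW.
have x0t : mdist x0 (g t) = t.
  have := gg 0 t; rewrite g0 -/d lexx (le_trans t0 td) t0 td => -> //.
  by rewrite sub0r normrN ger0_norm.
have xt : mdist (g t) x = d - t.
  have := gg t d; rewrite -/d t0 td lexx (le_trans t0 td) gd => -> //.
  by rewrite distrC ger0_norm// subr_ge0.
have [|q qs qt] := snet (g t); first by rewrite /= x0t.
have qx : mdist q x <= S / 2.
  by have := metric_triangle q (g t) x; lra.
have [_ fq] := fP q; have [q' q's q'x] := fq x qx.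
exists q' => //; apply/flattenP; exists (f q) => //.
by apply/mapP; exists q.
Qed.

Lemma bounded_net e J (x0 : M) : 0 < e -> e <= S ->
  (forall x, mdist x0 x <= J%:R * (S / 4)) ->
  exists2 s : seq M,
    (size s)%:R <= (256 ^+ n) ^+ J * (32 * S / e) ^+ n & net e setT s.
Proof.
move=> e0 eS bounded; have [s sz snet] := chain_net x0 J.
have [f fP] := choice (fun q => (exists2P _ _).1 (ball_net e q e0 eS)).
exists (flatten [seq f q | q <- s]).
  apply: (le_trans (size_flatten_le _ _ ((32 * S / e) ^+ n) _ _ _)).
    by move=> q; have [] := fP q.
  by rewrite ler_wpM2r// exprn_ge0// divr_ge0 ?mulr_ge0// ltW.
move=> x _; have [q qs qx] := snet x (bounded x).
have [_ fq] := fP q; have [|q' q's q'x] := fq x; first by rewrite /=; lra.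
by exists q' => //; apply/flattenP; exists (f q) => //; apply/mapP; exists q.
Qed.

End homothety_space.

(** [J] steps of length [S / 4] cover the diameter. The mesh [S * e / 2] is at most [S] for every
    [e <= 1], is at most [e / 2] because [S <= 1], and turns the packing ratio into [64 / e], free
    of [S]. *)
Lemma alexandrov_net (n : nat) (k D : R) : exists2 A : R, 1 <= A &
  forall M (x0 : M), compact [set: M] -> alexandrov_space M k ->
    hausdorff_dim [set: M] = n%:R%:E -> (diam [set: M] <= D%:E)%E ->
  forall e, 0 < e -> e <= 1 ->
  exists2 s : seq M, (size s)%:R <= A * e ^- n & net (e / 2) setT s.
Proof.
have [S /andP[S0 S1] HS] := curvature_homothety_bound k.
pose J := Num.bound (4 * D / S).
exists ((256 ^+ n) ^+ J * 64 ^+ n).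
  by rewrite -exprM mulr_ege1// exprn_ege1// ler1n.
move=> M x0 cpt [_ geo curv] dim diamD e e0 e1.
have eS0 : 0 < S * e / 2 by rewrite divr_gt0// mulr_gt0.
have eSS : S * e / 2 <= S.
  have : S * e <= S * 1 by rewrite ler_pM2l.
  by lra.
have bounded x : mdist x0 x <= J%:R * (S / 4).
  have xD : mdist x0 x <= D.
    by rewrite -lee_fin; apply: le_trans diamD; exact: le_diam.
  have D0 : 0 <= D by rewrite (le_trans _ xD)// mdist_ge0.
  have : 4 * D / S < J%:R by rewrite archi_boundP// divr_ge0 ?mulr_ge0// ltW.
  by rewrite ltr_pdivrMr//; lra.
have [s sz snet] := bounded_net _ _ _ cpt geo (HS M curv) dim S0 _ J x0 eS0 eSS bounded.
exists s.
  apply: (le_trans sz); rewrite -[leRHS]mulrA ler_wpM2l ?exprn_ge0//.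
  have -> : 32 * S / (S * e / 2) = 64 / e.
    by field; rewrite !gt_eqF.
  by rewrite exprMn exprVn.
move=> x /snet[q qs qx]; exists q => //; apply: (lt_le_trans qx).
have : S * e <= 1 * e by rewrite ler_pM2r.
lra.
Qed.

End covering.

(** * Transport to a net *)

Section measures.
Context d (T : measurableType d) (R : realType).

(** Normalizing a measure of total mass 1 leaves it unchanged; it only supplies the probability
    structure. *)
Lemma exists_sum_probability (mu : nat -> {measure set T -> \bar R}) (n : nat) :
  (\sum_(i < n) mu i setT = 1)%E ->
  exists P : probability T R, forall A, P A = (\sum_(i < n) mu i A)%E.
Proof.
move=> mu1.
pose Q : {measure set T -> \bar R} := msum mu n.
exists (mnormalize Q (dirac point)) => A.
have Q1 : Q setT = 1%E by exact: mu1.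
by rewrite /= /mnormalize Q1 onee_eq0 /= invr1 mule1.
Qed.

(** The integral of a nonnegative function is a supremum over the simple functions below it, and a
    larger function has more of these. The transport cost is thus bounded without measurability of
    the distance for the product sigma-algebra. *)
Lemma ge0_le_integral_nonmeasurable (mu : {measure set T -> \bar R})
    (f g : T -> \bar R) : (forall x, 0 <= f x)%E -> (forall x, f x <= g x)%E ->
  (\int[mu]_x f x <= \int[mu]_x g x)%E.
Proof.
move=> f0 fg; rewrite !ge0_integralTE//; last first.
  by move=> x; rewrite (le_trans (f0 x)).
apply: le_ereal_sup => _ [h hf <-]; exists h => // x.
exact: le_trans (hf x) (fg x).
Qed.

Lemma integral_two_values (P : probability T R) (G : set T) (a b : R) :
  measurable G -> 0 <= a -> 0 <= b ->
  (\int[P]_x (if x \in G then a else b)%:E <= a%:E + b%:E * P (~` G))%E.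
Proof.
move=> mG a0 b0.
have -> : (fun x => (if x \in G then a else b)%:E) =
    (fun x => a%:E * (\1_G x)%:E + b%:E * (\1_(~` G) x)%:E)%E.
  apply/funext => x; rewrite !indicE in_setC.
  by case: (x \in G) => /=; rewrite ?mule1 ?mule0 ?adde0 ?add0e.
have mi A : measurable A -> measurable_fun setT (EFin \o (\1_A : T -> R)).
  by move=> mA; apply: measurableT_comp => //; exact: measurable_indic.
have mGc : measurable (~` G) by exact: measurableC.
have p1 (c : R) A (x : T) : 0 <= c -> (0 <= c%:E * (\1_A x)%:E)%E.
  by move=> c0; rewrite -EFinM lee_fin mulr_ge0.
rewrite ge0_integralD//=; last 4 first.
- by move=> *; exact: p1.
- by apply: measurable_funeM; exact: mi.
- by move=> *; exact: p1.
- by apply: measurable_funeM; exact: mi.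
have m0 A : forall x : T, setT x -> (0 <= (\1_A x : R)%:E)%E.
  by move=> x _; rewrite lee_fin.
rewrite (ge0_integralZl_EFin _ measurableT (m0 G) (mi _ mG) a0).
rewrite (ge0_integralZl_EFin _ measurableT (m0 (~` G)) (mi _ mGc) b0).
rewrite !integral_indic ?setIT//.
by rewrite leeD2r// -[leRHS]mule1 lee_wpmul2l ?lee_fin// probability_le1.
Qed.

End measures.

Section mixtures.
Context {R : realType}.

Lemma exists_pushforward d1 d2 (T1 : measurableType d1) (T2 : measurableType d2)
    (m : {measure set T1 -> \bar R}) (f : T1 -> T2) :
  measurable_fun setT f ->
  exists m' : {measure set T2 -> \bar R}, forall A, m' A = m (f @^-1` A).
Proof. by move=> mf; unshelve eexists (pushforward m f : {measure set T2 -> \bar R}). Qed.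

(* [gam] moves the fraction [a i] of the mass of [mu] in [V i] to [q i], and the
   rest of it to [q 0]. *)
Lemma exists_transport d (T : measurableType d) (mu : probability T R)
    (N : nat) (V : nat -> set T) (q : nat -> T) (a : nat -> R) :
  (forall i, measurable (V i)) -> (forall i, 0 <= a i <= 1) ->
  (\sum_(i < N) mu (V i) = 1)%E ->
  exists gam : probability (T * T)%type R, forall A, gam A =
    (\sum_(i < N) ((a i)%:E * mu ([set x | A (q i, x)] `&` V i) +
                   (1 - a i)%:E * mu ([set x | A (q 0%N, x)] `&` V i)))%E.
Proof.
move=> mV a01 mu1.
have /choice[p pE] : forall ij : nat * nat, exists m' : {measure set (T * T)%type -> \bar R},
    forall A, m' A = mu ([set x | A (q ij.1, x)] `&` V ij.2).
  move=> [i j].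
  have [m' m'E] := @exists_pushforward _ _ T (T * T)%type (mrestr mu (mV j))
    (fun x => (q i, x)) (pair1_measurable (q i)).
  by exists m' => A; rewrite m'E.
have a0 i : 0 <= a i by have /andP[] := a01 i.
have a1 i : 0 <= 1 - a i by rewrite subr_ge0; have /andP[] := a01 i.
pose m i : {measure set (T * T)%type -> \bar R} :=
  measure_add (mscale (NngNum (a0 i)) (p (i, i)))
              (mscale (NngNum (a1 i)) (p (0%N, i))).
have mE i A : m i A = ((a i)%:E * mu ([set x | A (q i, x)] `&` V i) +
                   (1 - a i)%:E * mu ([set x | A (q 0%N, x)] `&` V i))%E.
  by rewrite [LHS]measure_addE /= /mscale /= !pE.
have [|gam gE] := @exists_sum_probability _ (T * T)%type R m N.
  rewrite -mu1; apply: eq_bigr => i _; rewrite mE.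
  have -> x : [set y | setT (q x, y)] `&` V i = V i by rewrite setTI.
  by rewrite -ge0_muleDl ?lee_fin// -EFinD addrC subrK mul1e.
by exists gam => A; rewrite gE; apply: eq_bigr => i _.
Qed.

Lemma exists_atomic d (T : measurableType d) (N : nat) (q : nat -> T) (c : nat -> R) :
  (forall i, 0 <= c i) -> \sum_(i < N) c i <= 1 ->
  exists P : probability T R, forall A, P A =
    (\sum_(i < N) ((c i)%:E * \d_(q i) A) +
      (1 - \sum_(i < N) c i)%:E * \d_(q 0%N) A)%E.
Proof.
move=> c0 c1; have c1' : 0 <= 1 - \sum_(i < N) c i by rewrite subr_ge0.
pose m i : {measure set T -> \bar R} :=
  (* The index [N] carries the leftover mass, placed at [q 0]. *)
  if (i < N)%N then (mscale (NngNum (c0 i)) (dirac (q i)) : {measure set T -> \bar R})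
  else (mscale (NngNum c1') (dirac (q 0%N)) : {measure set T -> \bar R}).
have mE A : (\sum_(i < N.+1) m i A = \sum_(i < N) ((c i)%:E * \d_(q i) A) +
      (1 - \sum_(i < N) c i)%:E * \d_(q 0%N) A)%E.
  rewrite big_ord_recr /= /m ltnn; congr (_ + _)%E.
  by apply: eq_bigr => i _; rewrite ltn_ord.
have [|P PE] := @exists_sum_probability _ T R m N.+1.
  rewrite mE diracT mule1; under eq_bigr do rewrite diracT mule1.
  by rewrite sumEFin -EFinD addrC subrK.
by exists P => A; rewrite PE mE.
Qed.

End mixtures.

(** * Covering the space of probability measures *)

Section wasserstein_covering.
Context {R : realType} (M : pmetricType R).
Implicit Types (mu : borel_probability M).

Lemma open_mdist_lt (p : M) (r : R) : open [set x | mdist p x < r].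
Proof.
rewrite openE => x /= px; apply/nbhs_ballP; exists (r - mdist p x) => /=.
  by rewrite subr_gt0.
move=> y; rewrite ballEmdist /= => xy.
by have := metric_triangle p x y; lra.
Qed.

Lemma open_borel (A : set M) : open A -> measurable (A : set (borel M)).
Proof. by move=> oA; apply: sub_gen_smallest. Qed.

Lemma measurable_set1_borel (p : borel M) : measurable [set p].
Proof.
rewrite -[X in measurable X]setCK; apply: measurableC; apply: open_borel.
rewrite openC; apply: accessible_closed_set1; apply: hausdorff_accessible.
exact: metric_hausdorff.
Qed.

Lemma W2_lt mu nu (e B : R) (gam : probability (borel M * borel M)%type R) :
  0 < e -> coupling mu nu gam -> (transport_cost gam <= B%:E)%E -> B < e ^+ 2 ->
  W2 mu nu < e.
Proof.
move=> e0 cg gB Be; rewrite /W2.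
set I := ereal_inf _.
(* The two bounds make the infimum finite, so [fine] does not alter it. *)
have I0 : (0 <= I)%E.
  apply: le_ereal_inf_tmp => _ [g _ <-]; apply: integral_ge0 => x _.
  by rewrite lee_fin mulr_ge0// sqr_ge0.
have IB : (I <= B%:E)%E.
  by apply: le_trans gB; apply: ereal_inf_lbound; exists gam.
rewrite -[ltRHS](ger0_norm (ltW e0)) -sqrtr_sqr ltr_sqrt ?exprn_gt0//.
apply: le_lt_trans Be; rewrite -lee_fin fineK//.
by rewrite ge0_fin_numE// (le_lt_trans IB)// ltry.
Qed.

(** The measure [nu] is given by its formula rather than constructed, so that the candidates, which
    depend on [f] only, can be fixed before [mu]. *)
Lemma transport_to_net (r D : R) (s : seq M) (m : nat) :
  (forall x : M, exists2 q, q \in s & mdist q x < r) ->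
  (forall x y : M, mdist x y <= D) -> 0 <= r -> 0 <= D -> (0 < m)%N ->
  forall mu, exists f : nat -> nat,
    (\sum_(i < size s) f i <= m)%N /\
    forall nu : borel_probability M,
      (forall A, nu A =
        (\sum_(i < size s) (((f i)%:R / m%:R)%:E * \d_(nth point s i : borel M) A) +
         (1 - \sum_(i < size s) ((f i)%:R / m%:R))%:E *
           \d_(nth point s 0%N : borel M) A)%E) ->
    exists2 gam, coupling nu mu gam & (transport_cost gam <=
      (2^-1 * r ^+ 2 + 2^-1 * D ^+ 2 * ((size s)%:R / m%:R))%:E)%E.
Proof.
move=> snet bD r0 D0 m0 mu.
set N := size s; pose q i : borel M := nth point s i.
(* The balls are continued by empty sets into a sequence, which [seqDU] makes disjoint. *)
pose F i : set (borel M) := if (i < N)%N then [set x : M | mdist (q i : M) x < r] else set0.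
have mF i : measurable (F i).
  by rewrite /F; case: ifP => // _; apply: open_borel; exact: open_mdist_lt.
pose V := seqDU F.
have mV i : measurable (V i) by exact: seqDU_measurable.
have tV : trivIset setT V by exact: trivIset_seqDU.
have tVij i j : i != j -> V i `&` V j = set0.
  move=> ij; apply/seteqP; split=> // x Vx.
  by move: ij; rewrite (tV i j Logic.I Logic.I (ex_intro _ x Vx)) eqxx.
have VF i x : V i x -> mdist (q i : M) x < r.
  by move=> Vx; have := @subset_seqDU _ F i x Vx; rewrite /F; case: ifP.
have cV : \big[setU/set0]_(i < N) V i = setT.
  rewrite -bigsetU_seqDU; apply/seteqP; split=> // x _.
  have [p ps px] := snet x; rewrite -bigcup_mkord.
  have iN : (index p s < N)%N by rewrite index_mem.
  by exists (index p s) => //; rewrite /F iN /= /q nth_index.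
have muV A : measurable A -> (mu A = \sum_(i < N) mu (A `&` V i))%E.
  move=> mA; rewrite -{1}(setIT A) -cV big_distrr /=.
  rewrite (measure_bigsetU mu (F := fun i => A `&` V i))//.
    by move=> i; exact: measurableI.
  apply/trivIsetP => i j _ _ ij.
  by rewrite setIACA tVij// setI0.
pose w i := fine (mu (V i)).
have wE i : (w i)%:E = mu (V i) by rewrite fineK// fin_num_measure.
have w0 i : 0 <= w i by rewrite fine_ge0.
have w1 : (\sum_(i < N) mu (V i) = 1)%E.
  by rewrite -(probability_setT mu) (muV setT)//; under [RHS]eq_bigr do rewrite setTI.
have w1' : \sum_(i < N) w i = 1.
  by apply: EFin_inj; rewrite -sumEFin; under eq_bigr do rewrite wE.
have m0' : (0 : R) < m%:R by rewrite ltr0n.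
pose f i := Num.truncn (m%:R * w i).
have f_le i : (f i)%:R <= m%:R * w i by rewrite truncn_le mulr_ge0// ltW.
have f_gt i : m%:R * w i < (f i)%:R + 1.
  have := @truncn_itv R (m%:R * w i); rewrite mulr_ge0// ?(ltW m0')//.
  by move=> /(_ isT)/andP[_]; rewrite -natr1.
have c_le i : (f i)%:R / m%:R <= w i by rewrite ler_pdivrMr// mulrC.
have f_sum : (\sum_(i < N) f i <= m)%N.
  rewrite -(ler_nat R) natr_sum (@le_trans _ _ (\sum_(i < N) m%:R * w i))//.
    by apply: ler_sum => i _; exact: f_le.
  by rewrite -mulr_sumr w1' mulr1.
exists f; split=> // nu nuE.
(* The fraction of the cell that goes to its own net point. On a null cell division by 0 gives 0,
   which is consistent as [f i] is 0 there. *)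
pose a i := (f i)%:R / m%:R / w i.
have aw i : a i * w i = (f i)%:R / m%:R.
  rewrite /a; have [wi0|wi0] := eqVneq (w i) 0; last by rewrite divfK.
  have fi0 : (f i)%:R / m%:R <= (0 : R) by have := c_le i; rewrite wi0.
  by rewrite wi0 mulr0; apply/eqP; rewrite eq_le fi0 divr_ge0.
have a01 i : 0 <= a i <= 1.
  apply/andP; split; first by rewrite /a !divr_ge0.
  have [wi0|wi0] := eqVneq (w i) 0; first by rewrite /a wi0 invr0 mulr0.
  have wp : 0 < w i by rewrite lt_neqAle eq_sym wi0 w0.
  by rewrite /a ler_pdivrMr// mul1r c_le.
have a0 i : 0 <= a i by have /andP[] := a01 i.
have a1 i : 0 <= 1 - a i by rewrite subr_ge0; have /andP[] := a01 i.
have [gam gE] := @exists_transport R _ (borel M) mu N V q a mV a01 w1.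
exists gam.
  move=> A mA; split.
    rewrite gE nuE.
    have setE x : [set y : borel M | (A `*` [set: borel M]) (x, y)] =
        if x \in A then setT else set0.
      case: ifPn => [/set_mem|/negP] xA; apply/seteqP; split=> y //=.
      by case=> Ax _; apply: xA; rewrite inE.
    have muE i x : mu ([set y : borel M | (A `*` [set: borel M]) (x, y)] `&` V i) =
        ((w i)%:E * \d_x A)%E.
      rewrite setE diracE; case: ifP => xA; rewrite ?setTI ?set0I ?measure0 ?mule0//.
      by rewrite mule1 wE.
    under eq_bigr do rewrite !muE.
    rewrite big_split /=; congr (_ + _)%E.
      by apply: eq_bigr => i _; rewrite muleA -EFinM aw.
    transitivity (\sum_(i < N) ((w i - (f i)%:R / m%:R)%:E * \d_(q 0%N) A))%E.
      by apply: eq_bigr => i _; rewrite muleA -EFinM mulrBl mul1r aw.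
    rewrite -ge0_sume_distrl => [|i _]; last by rewrite lee_fin subr_ge0.
    by rewrite sumEFin sumrB w1'.
  rewrite gE muV//; apply: eq_bigr => i _.
  have setE x : [set y : borel M | ([set: borel M] `*` A) (x, y)] = A.
    by apply/seteqP; split => y /=; [case|split].
  by rewrite !setE -ge0_muleDl ?lee_fin// -EFinD addrC subrK mul1e.
(* Pairs of a net point and a point of its own cell: there the cost is controlled by [r], and
   elsewhere by [D]. *)
pose G : set (borel M * borel M) := \bigcup_(i < N) ([set q i] `*` V i).
have mG : measurable G.
  apply: bigcup_measurable => i _; apply: measurableX => //.
  exact: measurable_set1_borel.
have Gdist x y : G (x, y) -> mdist (x : M) y < r.
  by move=> [i _] [/= ->]; exact: VF.
apply: (@le_trans _ _ (\int[gam]_xy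
    (if xy \in G then 2^-1 * r ^+ 2 else 2^-1 * D ^+ 2)%:E)%E).
  apply: ge0_le_integral_nonmeasurable => -[x y] /=.
    by rewrite lee_fin mulr_ge0// sqr_ge0.
  rewrite lee_fin; case: ifPn => [|_].
    rewrite inE => /Gdist /ltW xy; rewrite ler_pM2l//.
    by rewrite lerXn2r ?nnegrE ?mdist_ge0.
  by rewrite ler_pM2l// lerXn2r ?nnegrE ?mdist_ge0.
apply: (le_trans (@integral_two_values _ _ R gam G (2^-1 * r ^+ 2)
  (2^-1 * D ^+ 2) mG _ _)).
- by rewrite mulr_ge0// sqr_ge0.
- by rewrite mulr_ge0// sqr_ge0.
rewrite EFinD leeD2l// [leRHS]EFinM lee_wpmul2l ?lee_fin ?mulr_ge0 ?sqr_ge0//.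
rewrite gE -[N in N%:R]card_ord -sumr_const mulr_suml -sumEFin.
apply: lee_sum => i _.
(* Mass sent to the point of its own cell stays in [G], so only the excess counts. *)
have -> : [set x | (~` G) (q i, x)] `&` V i = set0.
  apply/seteqP; split=> // x [/= nG Vx]; apply: nG.
  by exists i => //=.
rewrite measure0 mule0 add0e.
apply: (@le_trans _ _ ((1 - a i)%:E * mu (V i))%E).
  apply: lee_wpmul2l; first by rewrite lee_fin.
  apply: le_measure; rewrite ?inE//.
    apply: measurableI => //.
    have := pair1_measurable (q 0%N : borel M) measurableT (measurableC mG).
    by rewrite setTI.
rewrite -wE -EFinM lee_fin.
(* Rounding down loses at most [1 / m] in each cell. *)
have -> : (1 - a i) * w i = w i - (f i)%:R / m%:R by rewrite mulrBl mul1r aw.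
rewrite ler_pdivlMr// mulrBl divfK ?gt_eqF//.
by have := f_gt i; lra.
Qed.

(** The centers are indexed by all maps from the net to multiplicities at most [m]; those of total
    above [m] get an arbitrary Dirac mass. The hypothesis on [m] bounds the cost by
    [e ^+ 2 / 8 + e ^+ 2 / 8], below [e ^+ 2]. *)
Lemma W2_covering_number (e D : R) (s : seq M) (m : nat) :
  (forall x : M, exists2 q, q \in s & mdist q x < e / 2) ->
  (forall x y : M, mdist x y <= D) -> 0 < e -> (0 < m)%N ->
  4 * D ^+ 2 * (size s)%:R <= e ^+ 2 * m%:R ->
  (covering_number (@W2 R M) e <= ((m.+1 ^ size s)%N%:R)%:E)%E.
Proof.
move=> snet bD e0 m0 Dm.
have D0 : 0 <= D by have := bD point point; rewrite mdistxx.
pose N := size s.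
have /choice[nu nuP] : forall g : {ffun 'I_N -> 'I_m.+1},
    exists nu : borel_probability M, (\sum_(i < N) g i <= m)%N ->
      forall A, nu A =
        (\sum_(i < N) (((g i)%:R / m%:R)%:E * \d_(nth point s i : borel M) A) +
         (1 - \sum_(i < N) ((g i)%:R / m%:R))%:E *
           \d_(nth point s 0%N : borel M) A)%E.
  move=> g; have [gm|_] := boolP (\sum_(i < N) g i <= m)%N; last first.
    by exists (dirac point).
  pose c i : R := if insub i is Some j then (g j)%:R / m%:R else 0.
  have cE (i : 'I_N) : c i = (g i)%:R / m%:R by rewrite /c valK.
  have [||P PE] := @exists_atomic R _ (borel M) N (nth point s) c.
  - by move=> i; rewrite /c; case: insub => // j; rewrite divr_ge0.
  - under eq_bigr do rewrite cE; rewrite -mulr_suml -natr_sum.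
    by rewrite ler_pdivrMr ?ltr0n// mul1r ler_nat.
  exists P => _ A; rewrite PE; congr (_ + _ * _)%E.
    by apply: eq_bigr => i _; rewrite cE.
  by congr ((1 - _)%:E); apply: eq_bigr => i _; exact: cE.
have cardE : #|{ffun 'I_N -> 'I_m.+1}| = (m.+1 ^ N)%N.
  by rewrite card_ffun !card_ord.
apply: ereal_inf_lbound; exists (m.+1 ^ N)%N => //=.
exists (fun i => nu (enum_val (cast_ord (esym cardE) i))) => mu.
have e2 : 0 <= e / 2 by rewrite divr_ge0// ltW.
have [f [fm fP]] := transport_to_net _ _ s m snet bD e2 D0 m0 mu.
have f_lt (i : 'I_N) : (f i < m.+1)%N.
  by rewrite ltnS (leq_trans _ fm)// (bigD1 i)//= leq_addr.
pose g : {ffun 'I_N -> 'I_m.+1} := [ffun i => Ordinal (f_lt i)].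
exists (cast_ord cardE (enum_rank g)); rewrite cast_ordK enum_rankK.
have [|gam cgam cost] := fP (nu g).
  move=> A; rewrite nuP; last by under eq_bigr do rewrite ffunE.
  congr (_ + _ * _)%E; first by apply: eq_bigr => i _; rewrite ffunE.
  by congr ((1 - _)%:E); apply: eq_bigr => i _; rewrite ffunE.
apply: (W2_lt _ _ _ _ _ e0 cgam cost).
have m0' : (0 : R) < m%:R by rewrite ltr0n.
have : D ^+ 2 * (N%:R / m%:R) <= e ^+ 2 / 4.
  by rewrite mulrA ler_pdivrMr//; move: Dm; rewrite -/N; lra.
have := exprn_gt0 2 e0; rewrite expr_div_n.
by set u := e ^+ 2; set v := D ^+ 2 * _; rewrite -mulrA -/v; lra.
Qed.

End wasserstein_covering.

(** * Logarithmic estimates *)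

Lemma le_ln_powR (R : realType) (x eta : R) : 0 < x -> 0 < eta ->
  ln x <= x `^ eta / eta.
Proof.
move=> x0 eta0; rewrite ler_pdivlMr// mulrC -ln_powR.
by apply: ltW; apply: ln_sublinear; rewrite powR_gt0.
Qed.

Lemma covering_number_ge0 (R : realType) (Y : Type) (dY : Y -> Y -> R) (r : R) :
  (0 <= covering_number dY r)%E.
Proof. by apply: le_ereal_inf_tmp => _ [N _ <-]; rewrite lee_fin. Qed.

(** With [N] at most [A * e ^- n] and [m] the least integer above [4 * D ^+ 2 * N%:R / e ^+ 2],
    [m.+1] is at most [B * e ^- n.+2]. Hence [ln m.+1] is at most [n.+2%:R * ln (B / e)], as
    [1 <= B], and this is multiplied by [N]. The sum [C] dominates both [n.+2%:R * A] and [B]. *)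
Lemma lne_W2_covering_number (R : realType) (n : nat) (k D : R) :
  exists C : R, 0 < C /\
    forall Omega : pmetricType R,
      compact [set: Omega] -> alexandrov_space Omega k ->
      hausdorff_dim [set: Omega] = n%:R%:E ->
      (diam [set: Omega] <= D%:E)%E ->
    forall eps : R, 0 < eps -> eps < 2^-1 ->
      (lne (covering_number (@W2 R Omega) eps)
        <= (C * eps ^- n * ln (C / eps))%:E)%E.
Proof.
have [A A1 HA] := alexandrov_net n k D.
pose B := 4 * D ^+ 2 * A + 2.
have A0 : 0 < A by lra.
have B2 : 2 <= B by rewrite lerDr mulr_ge0 ?(ltW A0)// mulr_ge0// sqr_ge0.
have nA : 0 <= n.+2%:R * A by rewrite mulr_ge0// ltW.
exists (n.+2%:R * A + B); split; first lra.
move=> M cpt alex dim diamD e e0 e12; set C := _ + B.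
have e1 : e <= 1 by lra.
have [s sz snet] := HA M point cpt alex dim diamD e e0 e1.
have bD (x y : M) : mdist x y <= D.
  by rewrite -lee_fin; apply: le_trans diamD; exact: le_diam.
set N := size s in sz.
have e2 : 0 < e ^+ 2 by rewrite exprn_gt0.
pose x := 4 * D ^+ 2 * N%:R / e ^+ 2.
have x0 : 0 <= x by rewrite divr_ge0 ?(ltW e2)// mulr_ge0// mulr_ge0// sqr_ge0.
pose m := (Num.truncn x).+1.
have xm : x < m%:R by have /andP[] := truncn_itv x0.
have mx : m.+1%:R <= x + 2.
  by have /andP[h _] := truncn_itv x0; rewrite /m -addn2 natrD; lra.
have cov : (covering_number (@W2 R M) e <= ((m.+1 ^ N)%N%:R)%:E)%E.
  apply: (W2_covering_number M e D s m) => //.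
    by move=> y; exact: snet.
  by rewrite [leRHS]mulrC -ler_pdivrMr// ltW.
apply: (@le_trans _ _ (lne ((m.+1 ^ N)%N%:R)%:E)).
  rewrite lee_lne// in_itv/= leey andbT; first exact: covering_number_ge0.
  by rewrite lee_fin.
rewrite lne_EFin; last by rewrite ltr0n expn_gt0.
rewrite lee_fin natrX lnXn// -(mulr_natl (ln _)).
have en1 : 1 <= e ^- n by rewrite -exprVn exprn_ege1// invf_ge1.
have eV1 : 1 <= e^-1 by rewrite invf_ge1.
have xB : x + 2 <= B * e ^- n.+2.
  have en2 : 1 <= e ^- n.+2 by rewrite -exprVn exprn_ege1.
  rewrite mulrDl; apply: lerD; last by rewrite ler_peMr.
  have -> : 4 * D ^+ 2 * A * e ^- n.+2 = 4 * D ^+ 2 * (A * e ^- n) / e ^+ 2.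
    by rewrite -(addn2 n) exprD invfM; ring.
  by rewrite ler_pM2r ?invr_gt0// ler_wpM2l// mulr_ge0// sqr_ge0.
have B0 : 0 < B by lra.
have lnm : ln (m.+1%:R : R) <= n.+2%:R * ln (B / e).
  apply: (@le_trans _ _ (ln (B * e ^- n.+2))).
    rewrite ler_ln ?posrE// ?mulr_gt0 ?invr_gt0 ?exprn_gt0//.
    exact: le_trans mx xB.
  rewrite -exprVn lnM ?posrE ?exprn_gt0 ?invr_gt0// lnXn ?invr_gt0//.
  rewrite lnM ?posrE ?invr_gt0// mulrDr -(mulr_natl (ln e^-1)).
  by rewrite lerD2r ler_peMl ?ler1n// ln_ge0//; lra.
have Be1 : 1 <= B / e by rewrite ler_pdivlMr// mul1r; lra.
have lnB0 : 0 <= ln (B / e) by rewrite ln_ge0.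
apply: (@le_trans _ _ (A * e ^- n * (n.+2%:R * ln (B / e)))).
  by apply: ler_pM => //; rewrite ln_ge0// ler1n.
rewrite mulrCA mulrA [n.+2%:R * _]mulrA.
apply: ler_pM => //.
- by rewrite mulr_ge0// (le_trans _ en1).
- by rewrite ler_wpM2r ?(le_trans _ en1)// /C; lra.
- rewrite ler_ln ?posrE ?divr_gt0//; last by rewrite /C; lra.
  by rewrite ler_pM2r ?invr_gt0// /C; lra.
Qed.

Theorem lemma3p2 (R : realType) (n : nat) (k D : R) :
  (exists C : R, 0 < C /\
    forall Omega : pmetricType R,
      compact [set: Omega] -> alexandrov_space Omega k ->
      hausdorff_dim [set: Omega] = n%:R%:E ->
      (diam [set: Omega] <= D%:E)%E ->
    forall eps : R, 0 < eps -> eps < 2^-1 ->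
      (lne (covering_number (@W2 R Omega) eps)
        <= (C * eps ^- n * ln (C / eps))%:E)%E) /\
  (forall eta : R, 0 < eta -> exists C_eta : R, 0 < C_eta /\
    forall Omega : pmetricType R,
      compact [set: Omega] -> alexandrov_space Omega k ->
      hausdorff_dim [set: Omega] = n%:R%:E ->
      (diam [set: Omega] <= D%:E)%E ->
    forall eps : R, 0 < eps -> eps < 2^-1 ->
      (lne (covering_number (@W2 R Omega) eps)
        <= (C_eta * eps `^ (- (n%:R + eta)))%:E)%E).
Proof.
have [C [C0 HC]] := lne_W2_covering_number R n k D.
split; first by exists C.
(* The constant comes from bounding [ln (C / e)] by [(C / e)] to the power [eta], divided by
   [eta]. *)
move=> eta eta0; exists (C * (C `^ eta / eta)); split.
  by rewrite mulr_gt0// divr_gt0// powR_gt0.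
move=> M cpt alex dim diamD e e0 e12; apply: le_trans (HC M cpt alex dim diamD e e0 e12) _.
rewrite lee_fin opprD powRD; last by rewrite (gt_eqF e0) implybT.
rewrite powRN powR_mulrn ?(ltW e0)//.
have -> : C * (C `^ eta / eta) * (e ^- n * e `^ - eta) =
    C * e ^- n * ((C * e^-1) `^ eta / eta).
  have <- : e^-1 `^ eta = e `^ (- eta).
    by rewrite -powR_inv1 ?(ltW e0)// -powRrM mulN1r.
  by rewrite powRM ?(ltW C0) ?invr_ge0 ?(ltW e0)//; ring.
rewrite ler_wpM2l ?mulr_ge0 ?(ltW C0) ?invr_ge0 ?exprn_ge0 ?(ltW e0)//.
by apply: le_ln_powR => //; rewrite divr_gt0.
Qed.
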